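(* Let $A=\Bbbk Q/I$ be a finite-dimensional triangular monomial algebra. Then the cup product on the Hochschild cohomology $\mathrm{HH}^*(A)=\bigoplus_{i\ge0}\mathrm{Ext}^i_{A\otimes_\Bbbk A^{\mathrm{op}}}(A,A)$ vanishes in positive degrees: for all $m,n\ge 1$, $x\in\mathrm{HH}^m(A)$ and $y\in\mathrm{HH}^n(A)$, one has $x\smile y=0$.
   Context: Let $\Bbbk$ be a field and $Q$ a finite quiver. $A=\Bbbk Q/I$ is a monomial algebra if $I$ is an ideal generated by paths (of length at least $2$); it is triangular if $Q$ has no oriented cycles. The cup product on Hochschild cohomology is the standard (Gerstenhaber) cup product, which makes $\mathrm{HH}^*(A)$ a graded-commutative algebra. *)

(* Defs.v *)
From HB Require Import structures.
From mathcomp Require Import all_boot all_order all_algebra.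
Set Implicit Arguments. Unset Strict Implicit. Unset Printing Implicit Defensive.
Import GRing.Theory.
Local Open Scope ring_scope.

(** * Hochschild cochain complex (bar-complex model) of a k-algebra
    given by a k-vector space M and a bilinear multiplication [mul].
    An n-cochain is a k-multilinear map M^n -> M, represented as a function
    on sequences of length n. *)
Section Hochschild.
Variables (R : nzRingType) (M : lmodType R) (mul : M -> M -> M).

Definition multilinear (n : nat) (f : seq M -> M) : Prop :=
  forall (u v : seq M) (x y : M) (c : R),
    (size u + size v).+1 = n ->
    f (u ++ (c *: x + y) :: v) = c *: f (u ++ x :: v) + f (u ++ y :: v).

Definition hdiff (n : nat) (f : seq M -> M) (s : seq M) : M :=
  mul (head 0 s) (f (behead s))
  + \sum_(i < n) ((-1) ^+ i.+1) *: f (take i s ++ mul (nth 0 s i) (nth 0 s i.+1) :: drop i.+2 s)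
  + ((-1) ^+ n.+1) *: mul (f (take n s)) (nth 0 s n).

Definition hcocycle (n : nat) (f : seq M -> M) : Prop :=
  multilinear n f /\ forall s, size s = n.+1 -> hdiff n f s = 0.

Definition hcoboundary (n : nat) (g : seq M -> M) : Prop :=
  exists h : seq M -> M, multilinear n.-1 h /\
    forall s, size s = n -> hdiff n.-1 h s = g s.

Definition hcup (m : nat) (f g : seq M -> M) (s : seq M) : M :=
  mul (f (take m s)) (g (drop m s)).
End Hochschild.

Section Quiver.
Variables (V E : finType) (src tgt : E -> V).

(** A path is a pair (v, [:: a_1; ...; a_l]) with src a_1 = v and
    tgt a_i = src a_(i+1); (v, [::]) is the trivial path e_v. *)
Definition valid_path (p : V * seq E) : bool :=
  match p.2 with
  | [::] => true
  | a :: w => (src a == p.1) && path (fun x y => tgt x == src y) a w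
  end.

Definition path_end (p : V * seq E) : V := last p.1 [seq tgt a | a <- p.2].

Definition triangular : Prop :=
  forall p : V * seq E, valid_path p -> p.2 != [::] -> path_end p != p.1.

Definition composable (w : seq E) : bool :=
  match w with [::] => false | a :: w' => path (fun x y => tgt x == src y) a w' end.

(** all words of arrows of length < #|V| (in a triangular quiver every path
    has length < #|V|) *)
Definition short_words : seq (seq E) :=
  flatten [seq [seq val t | t : l.-tuple E] | l <- iota 0 #|V|].

Variable rels : seq (seq E).

(** paths that are nonzero in kQ/I, I generated by the paths in [rels]:
    paths not containing any generator as a subpath *)
Definition nonzero_path (p : V * seq E) : bool :=
  valid_path p && ~~ has (fun r => infix r p.2) rels.

Definition basis_list : seq (V * seq E) :=
  [seq p <- [seq (v, w) | v <- enum V, w <- short_words] | nonzero_path p].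

Definition mbasis := seq_sub basis_list.

Definition concat_path (p q : V * seq E) : option (V * seq E) :=
  if path_end p == q.1 then Some (p.1, p.2 ++ q.2) else None.

Variable k : fieldType.


(** multiplication: concatenation of paths, zero if not composable or if
    the concatenation lies in I *)
Definition malg_mul (x y : {ffun mbasis -> k^o}) : {ffun mbasis -> k^o} :=
  [ffun p : mbasis => \sum_(b1 : mbasis) \sum_(b2 : mbasis)
      (if concat_path (val b1) (val b2) == Some (val p) then x b1 * y b2 else 0)].
End Quiver.


Notation malg src tgt rels k := {ffun @mbasis _ _ src tgt rels -> k^o}.

(* Main.v *)
Require Import Defs.
From HB Require Import structures.
From mathcomp Require Import all_boot all_order all_algebra.
From mathcomp Require Import ring.
Set Implicit Arguments. Unset Strict Implicit. Unset Printing Implicit Defensive.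
Import GRing.Theory.
Local Open Scope ring_scope.

(* Gerstenhaber's circle product satisfies delta(f o g) = f u g -+ g u f on cocycles.
   Once cochains are normalised with respect to the vertex idempotents, they only relate
   a word w of composable arrows to a path b parallel to w, and in a triangular quiver
   either w = b or none of w, b is a prefix of the other.  In the second case the cochain
   acts at a definite place, the first letter where w and b differ; in the case w = b its
   action can be distributed over the letters of its first argument so that the cocycle
   identity holds place by place.  Keeping in f o g only the terms in which f acts to the
   left of g removes g u f and leaves a cochain with differential +- f u g. *)

(** * The bar differential *)

(** Summed over all insertions, the circle product only shows that the two cup products agree up to
    sign in cohomology. To separate them, every term must record whether [f] acts to the left of
    [g], and this record must survive all products of neighbouring arguments. Such products change
    the number of arguments but not the concatenated word, so places are counted in letters of the
    word. The record is consistent if the part of a cochain at each single place satisfies its own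
    cocycle identity, where only the left outer term shifts places, by the length of its path. If
    the word differs from the value, this holds because removing a common first or last path moves
    the first difference by that length or not at all; the second claim requires that neither is a
    prefix of the other. If they coincide, no letter is distinguished, and this forces the
    artificial distribution over the first argument. In [g u f] the cochain [f] sees only letters
    behind the whole output of [g], hence behind the place of [g]: no such term is kept. *)

(* The inner terms of [hdiff]; the two outer ones are added in [hdiffE]. *)
Fixpoint bdiff (A : Type) (M : zmodType) (mul : A -> A -> A) (f : seq A -> M)
    (s : seq A) {struct s} : M :=
  if s is x :: ((y :: t) as s')
  then - f (mul x y :: t) - bdiff mul (fun r => f (x :: r)) s' else 0.

Arguments bdiff : simpl never.

Section BdiffTheory.
Variables (A : Type) (M : zmodType) (mul : A -> A -> A).
Implicit Types (f g : seq A -> M) (s : seq A).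

Lemma bdiff_cons2 f x y t :
  bdiff mul f (x :: y :: t)
  = - f (mul x y :: t) - bdiff mul (fun r => f (x :: r)) (y :: t).
Proof. by []. Qed.

Lemma bdiff_small f s : (size s <= 1)%N -> bdiff mul f s = 0.
Proof. by case: s => [|x [|y t]]. Qed.

Lemma eq_bdiff f g s :
  (forall r, (size r).+1 = size s -> f r = g r) -> bdiff mul f s = bdiff mul g s.
Proof.
elim: s f g => [|x [|y t] IH] f g fg //.
rewrite !bdiff_cons2 fg //; congr (_ - _); apply: IH => r sr.
by rewrite fg //= sr.
Qed.

Lemma bdiff_eq0 f s :
  (forall r, (size r).+1 = size s -> f r = 0) -> bdiff mul f s = 0.
Proof.
elim: s f => [|x [|y t] IH] f f0 //.
rewrite !bdiff_cons2 f0 // oppr0 IH ?subr0 // => r sr.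
by rewrite f0 //= sr.
Qed.

Lemma bdiff_additive (M' : zmodType) (phi : {additive M -> M'}) f s :
  bdiff mul (fun r => phi (f r)) s = phi (bdiff mul f s).
Proof.
elim: s f => [|x [|y t] IH] f; rewrite ?raddf0 //.
rewrite !bdiff_cons2 raddfB raddfN; congr (_ - _).
exact: (IH (fun r => f (x :: r))).
Qed.

Lemma bdiff_morph (M' : zmodType) (L : M -> M') f s :
  (forall x y, L (x - y) = L x - L y) ->
  bdiff mul (fun r => L (f r)) s = L (bdiff mul f s).
Proof.
move=> LB; have L0 : L 0 = 0 by rewrite -(subr0 0) LB subrr.
have LN x : L (- x) = - L x by rewrite -sub0r LB L0 sub0r.
elim: s f => [|x [|y t] IH] f; rewrite ?L0 //.
rewrite !bdiff_cons2 LB LN; congr (_ - _).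
exact: (IH (fun r => f (x :: r))).
Qed.

Lemma bdiffD f g s :
  bdiff mul (fun r => f r + g r) s = bdiff mul f s + bdiff mul g s.
Proof.
elim: s f g => [|x [|y t] IH] f g; rewrite ?addr0 //.
rewrite !bdiff_cons2 (IH (fun r => f (x :: r)) (fun r => g (x :: r))).
by rewrite !opprD addrACA.
Qed.

Lemma bdiffN f s : bdiff mul (fun r => - f r) s = - bdiff mul f s.
Proof. exact: (bdiff_additive (@GRing.opp M)). Qed.

Lemma bdiffB f g s :
  bdiff mul (fun r => f r - g r) s = bdiff mul f s - bdiff mul g s.
Proof. by rewrite bdiffD bdiffN. Qed.

Lemma bdiff_sum (I : Type) (r : seq I) (P : pred I) (F : I -> seq A -> M) s :
  bdiff mul (fun t => \sum_(i <- r | P i) F i t) s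
  = \sum_(i <- r | P i) bdiff mul (F i) s.
Proof.
elim: s F => [|x [|y t] IH] F; [by rewrite big1 | by rewrite big1 |].
rewrite bdiff_cons2 (IH (fun i r => F i (x :: r))) -opprD -big_split -sumrN.
by apply: eq_bigr => i _; rewrite /= opprD.
Qed.

End BdiffTheory.

Lemma bdiffZ (k : pzRingType) (M : lmodType k) (A : Type) (mul : A -> A -> A)
    (c : k) (f : seq A -> M) s :
  bdiff mul (fun r => c *: f r) s = c *: bdiff mul f s.
Proof. exact: (bdiff_additive mul ( *:%R c)). Qed.

Lemma bdiff_map (A B : Type) (M : zmodType) (mulA : A -> A -> A)
    (mulB : B -> B -> B) (v : A -> B) (f : seq B -> M) s :
  {morph v : x y / mulA x y >-> mulB x y} ->
  bdiff mulA (fun r => f (map v r)) s = bdiff mulB f (map v s).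
Proof.
move=> vM; elim: s f => [|x [|y t] IH] f //.
rewrite !map_cons !bdiff_cons2 map_cons vM; congr (_ - _); exact: (IH (fun r => f (v x :: r))).
Qed.

(** A product of the neighbours [i] and [i.+1] with [i < n] shortens the left block, which then uses
    [n.+1] entries of [s]; with [i >= n] it leaves that block alone. So entry [n] occurs in both
    summands, and the sign accounts for the [n] products passed over. *)
Lemma bdiff_split (k : pzRingType) (M : lmodType k) (A : Type) (mul : A -> A -> A)
    (phi : seq A -> seq A -> M) n s :
  (n < size s)%N ->
  bdiff mul (fun r => phi (take n r) (drop n r)) s
  = bdiff mul (fun u => phi u (drop n.+1 s)) (take n.+1 s)
    + (-1) ^+ n *: bdiff mul (phi (take n s)) (drop n s).
Proof.
elim: n s phi => [|n IH] s phi sn.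
  rewrite expr0 scale1r drop0 take0 [X in _ = X + _]bdiff_small ?add0r;
    last by case: s sn => [|x []].
  by apply: eq_bdiff => r _; rewrite take0 drop0.
case: s sn => [//|x [//|y t]] sn.
rewrite bdiff_cons2 -[take n.+2 _]/(x :: y :: take n t) bdiff_cons2.
rewrite -addrA; congr (_ + _).
rewrite (IH _ (fun u w => phi (x :: u) w)) // opprD exprS mulN1r scaleNr.
by congr (_ - _).
Qed.

(** * Multilinear cochains *)

Section Multilinear.
Variables (k : fieldType) (M : lmodType k).
Implicit Types (f g : seq M -> M).

Lemma multilinear_cons n f x :
  multilinear n.+1 f -> multilinear n (fun s => f (x :: s)).
Proof. by move=> fl u v y z c suv; rewrite -!cat_cons fl //= addSn suv. Qed.

Lemma multilinear0 n f u v :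
  multilinear n f -> (size u + size v).+1 = n -> f (u ++ 0 :: v) = 0.
Proof.
move=> fl suv; have := fl u v 0 0 1 suv; rewrite !scale1r addr0.
by move/eqP; rewrite -[X in X == _]addr0 (inj_eq (addrI _)) eq_sym => /eqP.
Qed.

Lemma multilinear_lin n f g (c : k) :
  multilinear n f -> multilinear n g -> multilinear n (fun s => c *: f s + g s).
Proof.
move=> fl gl u v x y d suv; rewrite fl // gl // !scalerDr !scalerA mulrC.
by rewrite addrACA.
Qed.

Lemma multilinearB n f g :
  multilinear n f -> multilinear n g -> multilinear n (fun s => f s - g s).
Proof.
move=> fl gl u v x y d suv; rewrite fl // gl // scalerBr opprD.
by rewrite addrACA.
Qed.

Lemma multilinearD n f g :
  multilinear n f -> multilinear n g -> multilinear n (fun s => f s + g s).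
Proof.
move=> fl gl u v x y d suv; rewrite fl // gl // scalerDr.
by rewrite addrACA.
Qed.

Lemma multilinearZ n f c :
  multilinear n f -> multilinear n (fun s => c *: f s).
Proof.
by move=> fl u v x y d suv; rewrite fl // scalerDr !scalerA mulrC.
Qed.

Lemma eq_multilinear n f g :
  (forall s, size s = n -> f s = g s) -> multilinear n f -> multilinear n g.
Proof.
move=> fg fl u v x y c suv.
by rewrite -!fg ?fl // size_cat /= addnS.
Qed.

Lemma multilinear_sum n (I : Type) (r : seq I) (P : pred I) (F : I -> seq M -> M) :
  (forall i, multilinear n (F i)) -> multilinear n (fun s => \sum_(i <- r | P i) F i s).
Proof.
move=> Fl u v x y c suv; rewrite scaler_sumr -big_split /=.
by apply: eq_bigr => i _; rewrite Fl.
Qed.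

End Multilinear.

Lemma belast_cat_cons (A : Type) (a x : A) u w :
  belast a (u ++ x :: w) = (a :: u) ++ belast x w.
Proof. by elim: u a => [|b u IH] a //=; rewrite IH. Qed.

(** * The Hochschild differential and the Leibniz rule for the cup product *)

Section Algebra.
Variables (k : fieldType) (M : lmodType k) (mul : M -> M -> M).
Hypothesis mulA : associative mul.
Hypothesis mul_linl : forall c x y z, mul (c *: x + y) z = c *: mul x z + mul y z.
Hypothesis mul_linr : forall c x y z, mul z (c *: x + y) = c *: mul z x + mul z y.
Implicit Types (f g : seq M -> M) (s u v w : seq M).

Lemma amulDl x y z : mul (x + y) z = mul x z + mul y z.
Proof. by rewrite -[x in LHS]scale1r mul_linl scale1r. Qed.
Lemma amulDr x y z : mul z (x + y) = mul z x + mul z y.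
Proof. by rewrite -[x in LHS]scale1r mul_linr scale1r. Qed.
Lemma amul0l z : mul 0 z = 0.
Proof. by apply: (addrI (mul 0 z)); rewrite -amulDl !addr0. Qed.
Lemma amul0r z : mul z 0 = 0.
Proof. by apply: (addrI (mul z 0)); rewrite -amulDr !addr0. Qed.
Lemma amulZl c x z : mul (c *: x) z = c *: mul x z.
Proof. by rewrite -[c *: x]addr0 mul_linl amul0l addr0. Qed.
Lemma amulZr c x z : mul z (c *: x) = c *: mul z x.
Proof. by rewrite -[c *: x]addr0 mul_linr amul0r addr0. Qed.
Lemma amulNl x z : mul (- x) z = - mul x z.
Proof. by rewrite -scaleN1r amulZl scaleN1r. Qed.
Lemma amulNr x z : mul z (- x) = - mul z x.
Proof. by rewrite -scaleN1r amulZr scaleN1r. Qed.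
Lemma amulBl x y z : mul (x - y) z = mul x z - mul y z.
Proof. by rewrite amulDl amulNl. Qed.
Lemma amulBr x y z : mul z (x - y) = mul z x - mul z y.
Proof. by rewrite amulDr amulNr. Qed.
Lemma amul_suml (I : Type) (r : seq I) (P : pred I) (F : I -> M) z :
  mul (\sum_(i <- r | P i) F i) z = \sum_(i <- r | P i) mul (F i) z.
Proof. by apply: (big_morph (mul^~ z)) => [x y|]; rewrite ?amulDl ?amul0l. Qed.
Lemma amul_sumr (I : Type) (r : seq I) (P : pred I) (F : I -> M) z :
  mul z (\sum_(i <- r | P i) F i) = \sum_(i <- r | P i) mul z (F i).
Proof. by apply: (big_morph (mul z)) => [x y|]; rewrite ?amulDr ?amul0r. Qed.

Lemma bdiff_mulr f z s : bdiff mul (fun r => mul (f r) z) s = mul (bdiff mul f s) z.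
Proof.
elim: s f => [|x [|y t] IH] f; rewrite ?amul0l // !bdiff_cons2 amulBl amulNl.
by congr (_ - _); apply: IH.
Qed.

Lemma bdiff_mull f z s : bdiff mul (fun r => mul z (f r)) s = mul z (bdiff mul f s).
Proof.
elim: s f => [|x [|y t] IH] f; rewrite ?amul0r // !bdiff_cons2 amulBr amulNr.
by congr (_ - _); apply: IH.
Qed.

Definition lpart f s := if s is x :: t then mul x (f t) else 0.
Definition rpart f s := if s is x :: t then mul (f (belast x t)) (last x t) else 0.

Lemma rpart_cat f u x w :
  rpart f (u ++ x :: w) = mul (f (u ++ belast x w)) (last x w).
Proof. by case: u => [|a u] //=; rewrite belast_cat_cons last_cat. Qed.

Lemma rpart_rcons f u x : rpart f (rcons u x) = mul (f u) x.
Proof. by rewrite -cats1 rpart_cat /= cats0. Qed.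

Lemma hdiffE n f s : size s = n.+1 ->
  hdiff mul n f s = lpart f s + bdiff mul f s - (-1) ^+ n *: rpart f s.
Proof.
case/lastP: s => [//|s z]; rewrite size_rcons => -[sz].
rewrite /hdiff rpart_rcons exprS mulN1r scaleNr nth_rcons sz ltnn eqxx.
have -> : take n (rcons s z) = s by rewrite -cats1 take_size_cat.
congr (_ + _ - _); first by case: (s).
have : size (rcons s z) = n.+1 by rewrite size_rcons sz.
move: (rcons s z) => {s sz z} t st.
elim: n t f st => [|n IH] [|x [|y t]] f // st; rewrite ?big_ord0 //.
rewrite bdiff_cons2 big_ord_recl expr1 scaleN1r [drop _ _]drop0; congr (_ + _).
rewrite -(IH (y :: t) (fun r => f (x :: r))); last exact: succn_inj.
rewrite -sumrN; apply: eq_bigr => i _.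
by rewrite exprS mulN1r scaleNr.
Qed.

Lemma multilinear_bdiff n f : multilinear n f -> multilinear n.+1 (bdiff mul f).
Proof.
move=> fl u; elim: u n f fl => [|a u IH] n f fl v x y c [suv].
  case: v suv => [|b v] suv; first by rewrite !bdiff_small // scaler0 addr0.
  rewrite !bdiff_cons2 mul_linl (fl [::]) //.
  rewrite (@eq_bdiff _ _ _ (fun r => f (_ :: r))
    (fun r => c *: f (x :: r) + f (y :: r))); last first.
    by move=> r [sr]; rewrite (fl [::]) //= sr -suv.
  by rewrite bdiffD bdiffZ scalerBr scalerN opprD addrACA opprD.
case: n fl suv => [|n] fl //= [suv].
have := IH _ _ (multilinear_cons a fl) v x y c (congr1 S suv).
case: u IH suv => [|b u] IH suv /=.
  rewrite !bdiff_cons2 mul_linr (fl [::]) //= => [->|].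
    by rewrite scalerBr scalerN opprD addrACA opprD.
  by rewrite -suv.
rewrite !bdiff_cons2 -!cat_cons (fl (mul a b :: u)) //= => [->|].
  by rewrite scalerBr scalerN opprD addrACA opprD.
by rewrite -suv.
Qed.

Lemma multilinear_lpart n f : multilinear n f -> multilinear n.+1 (lpart f).
Proof.
move=> fl [|a u] v x y c /= [suv]; first by rewrite mul_linl.
by rewrite fl // mul_linr.
Qed.

Lemma multilinear_rpart n f : multilinear n f -> multilinear n.+1 (rpart f).
Proof.
move=> fl u v x y c [suv]; case/lastP: v suv => [|v b] suv.
  by rewrite !cats1 !rpart_rcons mul_linr.
rewrite -!rcons_cons -!rcons_cat !rpart_rcons fl ?mul_linl //.
by rewrite -suv size_rcons addnS.
Qed.

Lemma multilinear_hdiff n f : multilinear n f -> multilinear n.+1 (hdiff mul n f).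
Proof.
move=> fl; apply: (@eq_multilinear _ _ _
  (fun s => lpart f s + bdiff mul f s - (-1) ^+ n *: rpart f s)) => [s ss|].
  by rewrite hdiffE.
apply: multilinearB; last by apply/multilinearZ/multilinear_rpart.
by apply: multilinearD; [apply: multilinear_lpart | apply: multilinear_bdiff].
Qed.

Lemma multilinear_hcup m n f g :
  multilinear m f -> multilinear n g -> multilinear (m + n) (hcup mul m f g).
Proof.
move=> fl gl u v x y c suv; rewrite /hcup.
have [lt_u|le_u] := ltnP (size u) m.
  have hT z : take m (u ++ z :: v) = u ++ z :: take (m - (size u).+1) v.
    by rewrite take_cat ltnNge (ltnW lt_u) /= -(subnSK lt_u).
  have hD z : drop m (u ++ z :: v) = drop (m - (size u).+1) v.
    by rewrite drop_cat ltnNge (ltnW lt_u) /= -(subnSK lt_u).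
  rewrite !hT !hD fl ?mul_linl // size_takel -?addSn ?subnKC //.
  by rewrite leq_subLR addSn suv leq_addr.
have hT z : take m (u ++ z :: v) = take m u by rewrite takel_cat.
have hD z : drop m (u ++ z :: v) = drop m u ++ z :: v.
  rewrite drop_cat; case: ltnP => // le_u'.
  have eu : size u = m by apply/eqP; rewrite eqn_leq le_u le_u'.
  by rewrite -eu subnn drop_size.
rewrite !hT !hD gl ?mul_linr // size_drop addnBAC // -subSn ?suv ?addKn //.
exact: leq_trans le_u (leq_addr _ _).
Qed.

(** The right outer term of the first factor and the left outer term of the second are both [f u]
    times [x] times [g w], with opposite signs. All other terms match after [bdiff_split]. *)
Lemma hcup_leibniz m n f g s : size s = (m + n).+1 ->
  hdiff mul (m + n) (hcup mul m f g) s
  = mul (hdiff mul m f (take m.+1 s)) (g (drop m.+1 s))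
    + (-1) ^+ m *: mul (f (take m s)) (hdiff mul n g (drop m s)).
Proof.
move=> ss; have lt_ms : (m < size s)%N by rewrite ss ltnS leq_addr.
rewrite !hdiffE ?size_drop ?size_takel ?ss ?subSn ?addKn ?leq_addr //.
rewrite (bdiff_split mul (fun u w => mul (f u) (g w))) // bdiff_mulr bdiff_mull.
have [u [x [w [-> su sw]]]] : exists u x w, [/\ s = u ++ x :: w, size u = m & size w = n].
  exists (take m s); case E: (drop m s) => [|x w].
    by move: lt_ms; rewrite ltnNge -subn_eq0 -size_drop E.
  exists x, w; rewrite -E cat_take_drop size_takel ?(ltnW lt_ms) //; split=> //.
  by have := size_drop m s; rewrite E ss subSn ?leq_addr // addKn => -[].
have -> : take m.+1 (u ++ x :: w) = rcons u x.
  by rewrite -cat_rcons take_size_cat ?size_rcons ?su.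
have -> : drop m.+1 (u ++ x :: w) = w.
  by rewrite -cat_rcons drop_size_cat ?size_rcons ?su.
have -> : take m (u ++ x :: w) = u by rewrite take_size_cat.
have -> : drop m (u ++ x :: w) = x :: w by rewrite drop_size_cat.
rewrite rpart_rcons rpart_cat /hcup take_size_cat // drop_size_cat //=.
have -> : lpart (fun s0 => mul (f (take m s0)) (g (drop m s0))) (u ++ x :: w)
          = mul (lpart f (rcons u x)) (g w).
  rewrite -cat_rcons; case E: (rcons u x) => [|a u'] /=.
    by move/(congr1 size): E; rewrite size_rcons.
  have su' : size u' = m by have := size_rcons u x; rewrite E su => -[].
  by rewrite take_size_cat ?drop_size_cat // mulA.
rewrite !amulDl !amulDr !amulNl !amulNr !amulZl !amulZr !mulA !scalerDr !scalerN !scalerA.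
rewrite -exprD -!addrA; congr (_ + (_ + _)).
by rewrite addKr.
Qed.
End Algebra.

(** * Normalisation with respect to orthogonal idempotents *)

Section Normalization.
Variables (k : fieldType) (M : lmodType k) (mul : M -> M -> M).
Hypothesis mulA : associative mul.
Hypothesis mul_linl : forall c x y z, mul (c *: x + y) z = c *: mul x z + mul y z.
Hypothesis mul_linr : forall c x y z, mul z (c *: x + y) = c *: mul z x + mul z y.
Variables (V : finType) (e : V -> M).
Hypothesis e_orth : forall u v, mul (e u) (e v) = if u == v then e u else 0.
Hypothesis mul1l : forall x, mul (\sum_v e v) x = x.
Hypothesis mul1r : forall x, mul x (\sum_v e v) = x.
Implicit Types (f g K : seq M -> M) (s u t : seq M).

Lemma multilinear_suml N K u t (I : Type) (r : seq I) (P : pred I) (F : I -> M) :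
  multilinear N K -> (size u + size t).+1 = N ->
  K (u ++ (\sum_(i <- r | P i) F i) :: t) = \sum_(i <- r | P i) K (u ++ F i :: t).
Proof.
move=> Kl sN; apply: (big_morph (fun x => K (u ++ x :: t))) => [x y|].
  by rewrite -[x in LHS]scale1r Kl // scale1r.
exact: multilinear0 Kl sN.
Qed.

(** Terms that leave the first argument alone cancel by induction. The others cancel in pairs;
    associativity enters only for the triple product at the head. *)
Lemma bdiff_bdiff f s : bdiff mul (bdiff mul f) s = 0.
Proof.
elim: s f => [|x [|y t] IH] f //; rewrite bdiff_cons2.
rewrite (@eq_bdiff _ _ _ (fun r => bdiff mul f (x :: r)) (fun r =>
    - (if r is z :: r' then f (mul x z :: r') else 0)
    - bdiff mul (fun r => f (x :: r)) r)); last first.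
  by case=> [|z r] _; [rewrite !bdiff_small // subr0 oppr0 | rewrite bdiff_cons2].
rewrite bdiffB IH subr0 bdiffN opprK; case: t IH => [|z t] IH.
  by rewrite !bdiff_small // oppr0 addr0.
by rewrite !bdiff_cons2 mulA opprB opprK addrA addrK subrr.
Qed.

(* Multiplying by two extra outer arguments turns the whole Hochschild differential into
   [- bdiff] (see [bdiff_wrap]), so that outer and inner terms are treated alike. *)
Definition wrap f s := lpart mul (rpart mul f) s.

Lemma wrap_ends f a s b : wrap f (a :: rcons s b) = mul a (mul (f s) b).
Proof. by rewrite /wrap /= rpart_rcons. Qed.

Lemma bdiff_rpart n f s b : size s = n.+1 ->
  bdiff mul (rpart mul f) (rcons s b)
  = mul (bdiff mul f s - (-1) ^+ n *: rpart mul f s) b.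
Proof.
case/lastP: s => [//|s y]; rewrite size_rcons => -[sn].
rewrite (@eq_bdiff _ _ _ _ (fun r => mul (f (take n r)) (head 0 (drop n r)))).
  rewrite (bdiff_split mul (fun u w => mul (f u) (head 0 w))); last first.
    by rewrite !size_rcons sn.
  have -> : take n.+1 (rcons (rcons s y) b) = rcons s y.
    by rewrite -cats1 take_size_cat // size_rcons sn.
  have -> : drop n.+1 (rcons (rcons s y) b) = [:: b].
    by rewrite -cats1 drop_size_cat // size_rcons sn.
  have -> : take n (rcons (rcons s y) b) = s.
    by rewrite -!cats1 -catA take_size_cat.
  have -> : drop n (rcons (rcons s y) b) = [:: y; b].
    by rewrite -!cats1 -catA drop_size_cat.
  rewrite bdiff_mulr // bdiff_cons2 [bdiff _ _ [:: b]]bdiff_small // rpart_rcons subr0.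
  by rewrite /= amulBl // amulZl // scalerN mulA.
case/lastP=> [|r z]; rewrite !size_rcons ?sn // => -[sr].
by rewrite rpart_rcons -cats1 take_size_cat // drop_size_cat.
Qed.

Lemma bdiff_wrap n f a s b : size s = n.+1 ->
  bdiff mul (wrap f) (a :: rcons s b) = - mul a (mul (hdiff mul n f s) b).
Proof.
move=> sn; rewrite hdiffE // -addrA amulDl // -(bdiff_rpart _ _ sn) amulDr //.
case: s sn => [//|x t] _; rewrite rcons_cons bdiff_cons2 /wrap /= rpart_rcons.
by rewrite bdiff_mull // opprD -!mulA.
Qed.

Lemma multilinear_wrap n f : multilinear n f -> multilinear n.+2 (wrap f).
Proof. by move=> fl; apply: multilinear_lpart => //; apply: multilinear_rpart. Qed.

Lemma eq_hdiff n f g s : size s = n.+1 ->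
  (forall r, size r = n -> f r = g r) -> hdiff mul n f s = hdiff mul n g s.
Proof.
move=> sn fg; rewrite !hdiffE //; case: s sn => [//|x t] [sn] /=.
rewrite !fg ?size_belast //; congr (_ + _ - _); apply: eq_bdiff => r [sr].
by rewrite fg // sr sn.
Qed.

Lemma hdiff_lin n c f g s : size s = n.+1 ->
  hdiff mul n (fun r => c *: f r + g r) s = c *: hdiff mul n f s + hdiff mul n g s.
Proof.
move=> sn; rewrite !hdiffE // bdiffD bdiffZ; case: s sn => [//|x t] _ /=.
rewrite mul_linl mul_linr !scalerBr !scalerDr !scalerA mulrC.
by rewrite [X in X - _]addrACA opprD [LHS]addrACA.
Qed.

Lemma hdiff_scale n c f s : size s = n.+1 ->
  hdiff mul n (fun r => c *: f r) s = c *: hdiff mul n f s.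
Proof.
move=> sn; rewrite !hdiffE // bdiffZ; case: s sn => [//|x t] _ /=.
by rewrite (amulZl mul_linl) (amulZr mul_linr) !scalerBr !scalerDr !scalerA mulrC.
Qed.

(** With the unit as both outer arguments [wrap] loses nothing, so this reduces to [bdiff_bdiff]. *)
Lemma hdiff_hdiff n f s : size s = n.+2 ->
  hdiff mul n.+1 (hdiff mul n f) s = 0.
Proof.
move=> sn; set x := hdiff _ _ _ _; pose one := \sum_v e v.
have -> : x = mul one (mul x one) by rewrite mul1l mul1r.
apply: oppr_inj; rewrite -bdiff_wrap // oppr0.
rewrite (@eq_bdiff _ _ _ _ (fun r => - bdiff mul (wrap f) r)).
  by rewrite bdiffN bdiff_bdiff oppr0.
case=> [|a r] sr; first by rewrite /= size_rcons sn in sr.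
case/lastP: r sr => [|r b] sr; first by rewrite /= size_rcons sn in sr.
have {}sr : size r = n.+1 by move: sr; rewrite /= !size_rcons sn => -[].
by rewrite wrap_ends (bdiff_wrap _ _ _ sr) opprK.
Qed.

(* Its coboundary corrects [K] to vanish on idempotents at argument [i.+1], once [K] does so
   at arguments 1 to [i]; argument 0 is the outer left one of [wrap]. *)
Fixpoint insert_idem i K s : M :=
  if s is a :: t then
    if i is i'.+1 then insert_idem i' (fun r => K (a :: r)) t
    else \sum_w K (mul a (e w) :: e w :: t)
  else 0.

(** [N] is the number of arguments. The bounds on [u] and [t] exclude the first and the last
    argument, which in [wrap] are the two outer ones. *)
Definition vanishes_on_idem i N K := forall u v t,
  (0 < size u <= i)%N -> (0 < size t)%N -> (size u + size t).+1 = N ->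
  K (u ++ e v :: t) = 0.

Definition balanced_on_idem i N K := forall u x v y t,
  (size u < i)%N -> (size u + size t).+2 = N ->
  K (u ++ mul x (e v) :: y :: t) = K (u ++ x :: mul (e v) y :: t).

Lemma vanishes_on_idem_cons i N K x :
  vanishes_on_idem i.+1 N.+1 K -> vanishes_on_idem i N (fun r => K (x :: r)).
Proof.
move=> Kv u v t /andP[_ le_u] t0 suN.
by rewrite -cat_cons Kv //= addSn suN.
Qed.

Lemma vanishes_on_idem_le i j N K : (i <= j)%N ->
  vanishes_on_idem j N K -> vanishes_on_idem i N K.
Proof.
by move=> le_ij Kv u v t /andP[u0 le_u]; apply: Kv; rewrite u0 (leq_trans le_u).
Qed.

Lemma bdiff_cons_at_idem N K x u a v t :
  vanishes_on_idem (size u).+1 N K -> (0 < size t)%N -> (size u + size t).+2 = N ->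
  bdiff mul K (x :: u ++ a :: e v :: t)
  = - bdiff mul (fun r => K (x :: r)) (u ++ a :: e v :: t).
Proof.
move=> Kv t0 sN; case: u Kv sN => [|b u] Kv sN.
  by rewrite bdiff_cons2 (Kv [:: mul x a]) ?oppr0 ?sub0r.
rewrite !cat_cons [LHS]bdiff_cons2 -cat_cons -cat_rcons (Kv (rcons _ a)) //.
- by rewrite oppr0 sub0r.
- by rewrite size_rcons /=.
by rewrite size_rcons /= -sN /= !addSn.
Qed.

(** Only the two products that involve [e v] survive. Any other one keeps [e v] as an argument, at
    position [size u] or [(size u).+1], where [K] vanishes. *)
Lemma bdiff_at_idem N K u x v y t :
  vanishes_on_idem (size u).+1 N K -> (size u + size t).+2 = N ->
  bdiff mul K (u ++ x :: e v :: y :: t)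
  = (-1) ^+ (size u).+1
    *: (K (u ++ mul x (e v) :: y :: t) - K (u ++ x :: mul (e v) y :: t)).
Proof.
elim: u N K => [|z u IH] N K Kv sN.
  rewrite expr1 scaleN1r cat0s !bdiff_cons2.
  have -> : bdiff mul (fun r => K (x :: e v :: r)) (y :: t) = 0.
    case: t sN => [//|z t] sN; apply: bdiff_eq0 => r [sr].
    by rewrite (Kv [:: x]) //= sr.
  by rewrite subr0 opprB opprK addrC.
case: N Kv sN => [//|N] Kv sN.
rewrite (@bdiff_cons_at_idem N.+1) //; first last.
- by rewrite -sN /= addnS.
- exact: vanishes_on_idem_le Kv.
rewrite (IH _ _ (vanishes_on_idem_cons z Kv)); last by case: sN.
by rewrite [in RHS]exprS mulN1r scaleNr.
Qed.

Lemma balanced_of_vanishes i N K :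
  (forall s, size s = N.+1 -> bdiff mul K s = 0) ->
  vanishes_on_idem i N K -> balanced_on_idem i N K.
Proof.
move=> K0 Kv u x v y t le_u sN; apply/eqP; rewrite -subr_eq0; apply/eqP.
rewrite -[LHS](signrZK (size u).+1) -(@bdiff_at_idem N) ?K0 ?scaler0 //;
  last exact: vanishes_on_idem_le Kv.
by rewrite size_cat /= !addnS sN.
Qed.

Lemma eq_insert_idem i K K' s :
  (forall r, size r = (size s).+1 -> K r = K' r) ->
  insert_idem i K s = insert_idem i K' s.
Proof.
elim: i s K K' => [|i IH] [|a t] K K' KK' //=.
  by apply: eq_bigr => w _; rewrite KK'.
by apply: IH => r sr; rewrite KK' //= sr.
Qed.

Lemma insert_idem_eq0 i K s :
  (forall r, size r = (size s).+1 -> K r = 0) -> insert_idem i K s = 0.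
Proof.
elim: i s K => [|i IH] [|a t] K K0 //=.
  by rewrite big1 // => w _; rewrite K0.
by apply: IH => r sr; rewrite K0 //= sr.
Qed.

Lemma insert_idem_lin i c K K' s :
  insert_idem i (fun r => c *: K r + K' r) s
  = c *: insert_idem i K s + insert_idem i K' s.
Proof.
elim: i s K K' => [|i IH] [|a t] K K' //=; rewrite ?scaler0 ?addr0 //.
by rewrite scaler_sumr -big_split.
Qed.

Lemma multilinear_insert_idem i N K :
  multilinear N.+1 K -> multilinear N (insert_idem i K).
Proof.
elim: i N K => [|i IH] N K Kl u v x y c suv.
  case: u suv => [|a u] suv /=.
    rewrite scaler_sumr -big_split /=; apply: eq_bigr => w _.
    by rewrite mul_linl (Kl [::]) //= -suv.
  rewrite scaler_sumr -big_split /=; apply: eq_bigr => w _.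
  by apply: (Kl (mul a (e w) :: e w :: u)); rewrite -suv.
case: u suv => [|a u] suv /=; last first.
  case: N suv Kl => [//|N] [suv] Kl.
  by rewrite (IH N) //; apply: multilinear_cons.
rewrite -insert_idem_lin; apply: eq_insert_idem => r sr.
by rewrite (Kl [::]) //= sr -suv.
Qed.

Lemma vanishes_insert_idem i N K :
  multilinear N.+1 K -> vanishes_on_idem i N.+1 K ->
  vanishes_on_idem i N (insert_idem i K).
Proof.
elim: i N K => [|i IH] N K Kl Kv [|x u] v t //= le_u t0 sN.
case: N sN Kl Kv => [//|N] [sN] Kl Kv; case: u le_u sN => [|b u] le_u sN.
  case: i le_u {IH} Kv => [|i] le_u Kv /=.
    rewrite big1 // => w _; rewrite e_orth; case: eqP => _.
      by rewrite (Kv [:: x]) //= -sN.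
    by rewrite (multilinear0 (u := [:: x]) Kl) //= -sN.
  by apply: insert_idem_eq0 => r sr; rewrite (Kv [:: x]) ?sr //= -sN.
apply: (IH N) => //; first exact: multilinear_cons.
exact: vanishes_on_idem_cons.
Qed.

(** The sum of the tensors of [e w] with itself is the separability idempotent of the subalgebra
    spanned by the vertices, and inserting it acts as a contracting homotopy at a vertex argument.
    If [K] is a cocycle the last sum is 0, and what remains is [K] up to sign. *)
Lemma insert_idem_new N K u a v t :
  multilinear N K -> vanishes_on_idem (size u) N K ->
  (0 < size t)%N -> (size u + size t).+2 = N ->
  bdiff mul (insert_idem (size u) K) (u ++ a :: e v :: t)
  = (-1) ^+ (size u).+1 *: K (u ++ a :: e v :: t)
    - \sum_w bdiff mul K (u ++ mul a (e w) :: e w :: e v :: t).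
Proof.
move=> + + t0; elim: u N K => [|x u IH] N K Kl Kv sN.
  rewrite expr1 scaleN1r [LHS]bdiff_cons2 /= bdiff_sum.
  (* The separability idempotent commutes with [e v]: by orthogonality both sums reduce to the term
     [w = v]. *)
  have -> : \sum_w K [:: mul (mul a (e v)) (e w), e w & t]
      = \sum_w K [:: mul a (e w), mul (e w) (e v) & t].
    apply: eq_bigr => w _; rewrite -mulA !e_orth eq_sym.
    case: eqP => [->//|_]; rewrite amul0r //.
    by rewrite (multilinear0 (u := [::]) Kl) // (multilinear0 (u := [:: _]) Kl).
  have -> : K [:: a, e v & t] = \sum_w K (mul a (e w) :: e v :: t).
    rewrite -(multilinear_suml (u := [::]) _ _ _ Kl) //=.
    by rewrite -amul_sumr // mul1r.
  rewrite -!sumrN -!big_split /=; apply: eq_bigr => w _.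
  rewrite !bdiff_cons2 -[mul (mul a _) _]mulA [mul (e w) (e w)]e_orth eqxx.
  by rewrite [- (- _ - _)]opprB opprK [RHS]addrC addrK.
case: N Kl Kv sN => [//|N] Kl Kv [sN] /=.
have Kxv := vanishes_on_idem_cons x Kv.
rewrite exprS mulN1r scaleNr.
rewrite (@bdiff_cons_at_idem N) //; last exact: vanishes_insert_idem.
rewrite [X in - X](IH N) //; last exact: multilinear_cons.
rewrite opprB addrC -sumrN; congr (_ + _); apply: eq_bigr => w _.
rewrite (@bdiff_cons_at_idem N.+1) ?opprK //=; last by rewrite -sN addnS.
Qed.

Lemma balanced_insert_idem i N K :
  balanced_on_idem i N.+1 K -> balanced_on_idem i N (insert_idem i K).
Proof.
elim: i N K => [|i IH] N K Kb // [|z u] x v y t /= le_u sN; last first.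
  case: N sN Kb => [//|N] [sN] Kb; apply: (IH N) => // u' x' v' y' t' lt_u s'N.
  by rewrite -!cat_cons Kb //= -s'N.
case: i le_u {IH} Kb => [|i] _ Kb /=.
  apply: eq_bigr => w _; rewrite -mulA.
  by rewrite (Kb [::]) //= -sN.
by apply: eq_insert_idem => r sr; rewrite (Kb [::]) //= sr -sN.
Qed.

Lemma insert_idem_mull i z K s :
  insert_idem i (fun r => mul z (K r)) s = mul z (insert_idem i K s).
Proof.
elim: i K s => [|i IH] K [|a t] /=; rewrite ?amul0r //.
by rewrite amul_sumr.
Qed.

Lemma insert_idem_rpart i f r b : (i < size r)%N ->
  insert_idem i (rpart mul f) (rcons r b) = mul (insert_idem i f r) b.
Proof.
elim: i f r => [|i IH] f [|a r] // lt_ir.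
  rewrite rcons_cons /= amul_suml //; apply: eq_bigr => w _.
  exact: (rpart_rcons mul f (mul a (e w) :: e w :: r) b).
rewrite rcons_cons /= -(IH (fun t => f (a :: t))) //.
apply: eq_insert_idem => t; case: t => [//|x t _] /=.
by [].
Qed.

(** Chosen so that its [wrap] is [insert_idem i (wrap f)]. For [i = 0] the insertion happens at the
    outer left argument of [wrap], and the first copy of [e w] becomes a factor of the value. *)
Definition contraction i f : seq M -> M :=
  if i is i'.+1 then insert_idem i' f
  else fun r => \sum_w mul (e w) (f (e w :: r)).

Lemma wrap_contraction i f a r b : (i <= size r)%N ->
  wrap (contraction i f) (a :: rcons r b) = insert_idem i (wrap f) (a :: rcons r b).
Proof.
case: i => [|i] le_ir; rewrite wrap_ends /=.
  rewrite amul_suml // amul_sumr //; apply: eq_bigr => w _.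
  rewrite [RHS](wrap_ends f (mul a (e w)) (e w :: r) b).
  by rewrite -!mulA.
by rewrite insert_idem_mull insert_idem_rpart.
Qed.

Lemma multilinear_contraction i m f :
  multilinear m.+1 f -> multilinear m (contraction i f).
Proof.
case: i => [|i] fl /=; last exact: multilinear_insert_idem.
apply: multilinear_sum => w u v x y c suv.
by rewrite -!cat_cons fl ?mul_linr // -suv.
Qed.

Lemma list_ends m s : size s = m.+2 ->
  exists a r b, s = a :: rcons r b /\ size r = m.
Proof.
case: s => [//|a s]; case/lastP: s => [//|s b] /=.
by rewrite size_rcons => -[sm]; exists a, s, b.
Qed.

Definition cocycle m f := forall s, size s = m.+1 -> hdiff mul m f s = 0.

Lemma bdiff_wrap_cocycle m f s :
  cocycle m f -> size s = m.+3 -> bdiff mul (wrap f) s = 0.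
Proof.
move=> fc /list_ends[a [r [b [-> sr]]]].
by rewrite (bdiff_wrap _ _ _ sr) fc // amul0l // amul0r // oppr0.
Qed.

(** The sign [(-1) ^+ i] makes the correction cancel [K] at argument [i.+1], by [insert_idem_new].
    At the earlier arguments the correction is a difference of the two values compared in
    [balanced_on_idem], and [L] inherits balancedness from the cocycle [K]; so nothing already
    achieved is lost. *)
Lemma normalization_step i m f : (i <= m)%N ->
  multilinear m.+1 f -> cocycle m.+1 f -> vanishes_on_idem i m.+3 (wrap f) ->
  exists h, multilinear m h /\
    vanishes_on_idem i.+1 m.+3 (wrap (fun s => f s - hdiff mul m h s)).
Proof.
move=> le_im fl fc Kv; set K := wrap f in Kv; set L := insert_idem i K.
have Kl : multilinear m.+3 K by apply: multilinear_wrap.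
exists (fun s => (-1) ^+ i *: contraction i f s); split.
  exact/multilinearZ/multilinear_contraction.
have K0 s : size s = m.+4 -> bdiff mul K s = 0 by apply: bdiff_wrap_cocycle.
have Lv : vanishes_on_idem i m.+2 L by apply: vanishes_insert_idem.
have Lb : balanced_on_idem i m.+2 L.
  exact/balanced_insert_idem/balanced_of_vanishes.
have key q : size q = m.+3 ->
    wrap (fun s => f s - hdiff mul m (fun s => (-1) ^+ i *: contraction i f s) s) q
    = K q + (-1) ^+ i *: bdiff mul L q.
  move=> sq; have [a [r [b [qE sr]]]] := list_ends sq.
  have -> : bdiff mul L q = bdiff mul (wrap (contraction i f)) q.
    apply: eq_bdiff => t; rewrite sq => -[] /list_ends[a' [r' [b' [-> sr']]]].
    by rewrite wrap_contraction // sr'.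
  rewrite [X in bdiff _ _ X]qE (bdiff_wrap _ _ _ sr) scalerN -amulZr // -amulZl //.
  rewrite qE wrap_ends amulBl // amulBr // -wrap_ends; congr (_ - mul _ (mul _ _)).
  exact: hdiff_scale.
move=> u v t /andP[u0 le_u] t0 sN.
rewrite key; last by rewrite size_cat /= addnS.
case/lastP: u u0 le_u sN => [//|u x] _; rewrite size_rcons ltnS => le_u sN.
rewrite !cat_rcons; move: le_u; rewrite leq_eqVlt => /orP[/eqP eu|lt_u].
  rewrite /L -eu (@insert_idem_new m.+3) ?eu //; last by rewrite -eu -sN.
  rewrite big1 ?subr0 => [|w _].
    by rewrite exprS mulN1r scaleNr scalerN signrZK subrr.
  by rewrite K0 // size_cat /= -sN !addnS.
rewrite -cat_rcons Kv ?size_rcons ?lt_u //.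
rewrite add0r cat_rcons; case: t t0 sN => [//|y t] _ sN.
have {}sN : (size u + size t).+2 = m.+2 by case: sN => <-; rewrite addnS.
rewrite (@bdiff_at_idem m.+2) //; first last.
- exact: vanishes_on_idem_le Lv.
by rewrite Lb ?subrr ?scaler0.
Qed.

Definition normal m f := forall u v t, (size u + size t).+1 = m -> f (u ++ e v :: t) = 0.

Lemma wrap_one f s : wrap f ((\sum_v e v) :: rcons s (\sum_v e v)) = f s.
Proof. by rewrite wrap_ends mul1r mul1l. Qed.

Lemma eq_wrap m f g s : size s = m.+2 ->
  (forall r, size r = m -> f r = g r) -> wrap f s = wrap g s.
Proof. by move=> /list_ends[a [r [b [-> sr]]]] fg; rewrite !wrap_ends fg. Qed.

Lemma cocycleB m f h : cocycle m.+1 f ->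
  cocycle m.+1 (fun s => f s - hdiff mul m h s).
Proof.
move=> fc s sm.
rewrite (@eq_hdiff _ _ (fun s => (-1) *: hdiff mul m h s + f s)) //.
  by rewrite hdiff_lin // fc // hdiff_hdiff // scaler0 addr0.
by move=> r _; rewrite scaleN1r addrC.
Qed.

(** The step is iterated up to argument [m.+1] of [wrap], which is the last argument of [f];
    [wrap_one] then removes the outer arguments. It starts from an empty condition, with [h = 0]. *)
Lemma cocycle_normalization m f : multilinear m.+1 f -> cocycle m.+1 f ->
  exists h, [/\ multilinear m h,
    multilinear m.+1 (fun s => f s - hdiff mul m h s),
    cocycle m.+1 (fun s => f s - hdiff mul m h s)
    & normal m.+1 (fun s => f s - hdiff mul m h s)].
Proof.
move=> fl fc.
have B h : multilinear m h -> multilinear m.+1 (fun s => f s - hdiff mul m h s).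
  by move=> hl; apply: multilinearB fl _; apply: multilinear_hdiff.
suff [h [hl hv]] : exists h, multilinear m h /\
    vanishes_on_idem m.+1 m.+3 (wrap (fun s => f s - hdiff mul m h s)).
  exists h; split; [by [] | exact: B | exact: cocycleB |].
  move=> u v t sN.
  rewrite -(wrap_one (fun s => f s - hdiff mul m h s) (u ++ e v :: t)).
  rewrite rcons_cat rcons_cons -cat_cons hv //.
  - by rewrite /= -sN !ltnS leq_addr.
  - by rewrite size_rcons.
  by rewrite size_rcons /= addnS addSn sN.
elim: {1 3}m.+1 (leqnn m.+1) => [|i IH] le_im.
  exists (fun=> 0); split=> [u v x y c _|u v t /andP[]]; rewrite ?scaler0 ?addr0 //.
  by move=> u0 u1; have := leq_trans u0 u1.
have [h [hl hv]] := IH (ltnW le_im).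
have [h' [h'l h'v]] := normalization_step (le_im : (i <= m)%N) (B h hl) (cocycleB h fc) hv.
exists (fun s => 1 *: h s + h' s); split; first exact: multilinear_lin.
move=> u v t u0 t0 sN; rewrite -[RHS](h'v u v t) //.
apply: (@eq_wrap m.+1) => [|r sr]; first by rewrite size_cat /= addnS.
by rewrite hdiff_lin // scale1r opprD addrA.
Qed.

(** * Normalised cocycles are bilinear and balanced over the vertex idempotents *)

Section NormalCocycle.
Variables (m : nat) (f : seq M -> M).
Hypothesis fc : cocycle m.+1 f.
Hypothesis fn : normal m.+1 f.

Lemma normal_vanishes i : vanishes_on_idem i m.+1 f.
Proof. by move=> u v t _ _; apply: fn. Qed.

(** In the cocycle identity at [e v, x, t] normality leaves only the left outer term and the first
    product. The next two lemmas place [e v] at the end and in the middle instead. *)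
Lemma normal_head v x t : size t = m -> mul (e v) (f (x :: t)) = f (mul (e v) x :: t).
Proof.
move=> st; have st2 : size [:: e v, x & t] = m.+2 by rewrite /= st.
have := fc st2; rewrite hdiffE //= (@fn [::]) ?size_belast ?st //.
rewrite amul0l // scaler0 subr0 bdiff_cons2 [X in - _ - X]bdiff_eq0 => [|r [sr]].
  by rewrite subr0 => /eqP; rewrite subr_eq0 => /eqP.
by rewrite (@fn [::]) // sr st.
Qed.

Lemma normal_last v x t : size t = m ->
  mul (f (rcons t x)) (e v) = f (rcons t (mul x (e v))).
Proof.
move=> st; have st2 : size (rcons (rcons t x) (e v)) = m.+2 by rewrite !size_rcons st.
have := fc st2; rewrite hdiffE // rpart_rcons.
have -> : lpart mul f (rcons (rcons t x) (e v)) = 0.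
  case: t st {st2} => [|a t] st /=; first by rewrite (@fn [::]) ?(amul0r mul_linr) -?st.
  by rewrite -cats1 (@fn (rcons t x) v [::]) ?(amul0r mul_linr) // size_rcons /= addn0 -st.
rewrite (@eq_bdiff _ _ _ _ (fun r => f (take m r ++ drop m r))); last first.
  by move=> r _; rewrite cat_take_drop.
rewrite (bdiff_split mul (fun u w => f (u ++ w))); last by rewrite st2.
have -> : take m (rcons (rcons t x) (e v)) = t by rewrite -!cats1 -catA take_size_cat.
have -> : drop m (rcons (rcons t x) (e v)) = [:: x; e v].
  by rewrite -!cats1 -catA drop_size_cat.
have -> : take m.+1 (rcons (rcons t x) (e v)) = rcons t x.
  by rewrite -cats1 take_size_cat // size_rcons st.
have -> : drop m.+1 (rcons (rcons t x) (e v)) = [:: e v].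
  by rewrite -cats1 drop_size_cat // size_rcons st.
rewrite [bdiff _ _ (rcons t x)]bdiff_eq0 ?add0r => [|r].
  rewrite bdiff_cons2 [bdiff _ _ [:: _]]bdiff_small // subr0 exprS mulN1r scaleNr.
  rewrite opprK -scalerDr => /(congr1 ( *:%R ((-1) ^+ m))).
  rewrite signrZK scaler0 cats1 addrC => /eqP.
  by rewrite subr_eq0 => /eqP.
rewrite size_rcons st => -[sr].
by rewrite cats1 -cats1 (@fn r v [::]) // addn0 sr.
Qed.

Lemma normal_balanced u x v y t : (size u + size t).+2 = m.+1 ->
  f (u ++ mul x (e v) :: y :: t) = f (u ++ x :: mul (e v) y :: t).
Proof.
move=> sN; have sN2 : size (u ++ [:: x, e v, y & t]) = m.+2.
  by rewrite size_cat /= !addnS sN.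
have := fc sN2; rewrite hdiffE // rpart_cat /=.
rewrite -[u ++ [:: x, e v & belast y t]]cat_rcons (@fn (rcons u x)).
  rewrite amul0l // scaler0 subr0 (@bdiff_at_idem m.+1) //; last exact: normal_vanishes.
  have -> : lpart mul f (u ++ [:: x, e v, y & t]) = 0.
    case: u sN {sN2} => [|a u] sN /=.
      by rewrite (@fn [::]) ?amul0r //= -sN.
    rewrite -cat_rcons (@fn (rcons u x)) ?amul0r //.
    by rewrite size_rcons -sN /= addnS.
  rewrite add0r => /eqP; rewrite scaler_eq0 signr_eq0 /=.
  by rewrite subr_eq0 => /eqP.
by rewrite size_rcons size_belast -sN addSn.
Qed.
End NormalCocycle.
End Normalization.

(** A shift of the index by [d]; the hypothesis disposes of the indices that the shift pushes past
    the cut-off [N]. *)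
Lemma big_nat_shift (W : zmodType) (N c d : nat) (F : nat -> nat -> W) :
  (forall l j, (N <= d + j)%N -> F l j = 0) ->
  \sum_(0 <= j < N) (if (d <= j)%N then F (c + j)%N (j - d)%N else 0)
  = \sum_(0 <= j < N) F (c + d + j)%N j.
Proof.
move=> F0; have [le_Nd|lt_dN] := leqP N d.
  rewrite !big1_seq // => j; rewrite mem_index_iota => /andP[_ /andP[_ lt_jN]].
    by rewrite F0 // (leq_trans le_Nd) ?leq_addr.
  by rewrite leqNgt (leq_trans lt_jN le_Nd).
rewrite (big_cat_nat (n := d)) ?(ltnW lt_dN) //=.
rewrite [X in X + _]big1_seq ?add0r => [|j]; last first.
  by rewrite mem_index_iota => /andP[_ /andP[_ lt_jd]]; rewrite leqNgt lt_jd.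
rewrite -{1}[d]add0n big_addn [RHS](big_cat_nat (n := N - d)) ?leq_subr //=.
rewrite [X in _ = _ + X]big1_seq ?addr0 => [|j]; last first.
  rewrite mem_index_iota => /andP[_ /andP[le_j _]].
  by rewrite F0 // -leq_subLR.
by apply: eq_bigr => j _; rewrite leq_addl addnK -addnA [(d + j)%N]addnC.
Qed.

(** * The circle product with f to the left of g *)

Section CircleProduct.
Variables (k : fieldType) (M : lmodType k) (mul : M -> M -> M).
Hypothesis mul_linl : forall c x y z, mul (c *: x + y) z = c *: mul x z + mul y z.
Hypothesis mul_linr : forall c x y z, mul z (c *: x + y) = c *: mul z x + mul z y.
Variables (X : Type) (dg : X -> nat) (vl : X -> M) (mulX : X -> X -> X).
Hypothesis dgM : forall a b, dg (mulX a b) = (dg a + dg b)%N.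
Hypothesis vlM : {morph vl : a b / mulX a b >-> mul a b}.
Variables (n N : nat) (G : nat -> seq M -> M).
Hypothesis n_gt0 : (0 < n)%N.
(** The cocycle identity at the single place [j]. In the left outer term, letter [j] of the whole
    word is letter [j - dg a] of the word behind [a]; if it lies inside [a], there is no such
    term. *)
Hypothesis G_cocycle : forall j a s, size s = n ->
  (if (dg a <= j)%N then mul (vl a) (G (j - dg a) s) else 0)
  + bdiff mul (G j) (vl a :: s) - (-1) ^+ n *: rpart mul (G j) (vl a :: s) = 0.
Hypothesis G_bounded : forall j a s, size s = n ->
  (N <= dg a + j)%N -> mul (vl a) (G j s) = 0.
Implicit Types (K F : nat -> seq M -> M) (s : seq X) (a : X) (c d : nat).

(* [K c] stands for the part of a cochain acting before letter [c] of its word, [G j] for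
   the part of another one acting at letter [j] of its own word; [c] counts the letters
   already passed, so that only insertions to the right of [K]'s place are summed. *)
Definition insert_first c K s : M :=
  \sum_(0 <= j < N) K (c + j)%N (G j (map vl (take n s)) :: map vl (drop n s)).

Fixpoint circle l c K s : M :=
  if l is l'.+1 then
    insert_first c K s
    - (-1) ^+ n *: (if s is a :: t
                    then circle l' (c + dg a) (fun c r => K c (vl a :: r)) t else 0)
  else 0.

Lemma circle_cons l c K a t :
  circle l.+1 c K (a :: t) = insert_first c K (a :: t)
    - (-1) ^+ n *: circle l (c + dg a) (fun c r => K c (vl a :: r)) t.
Proof. by []. Qed.

(** The products among the first [n.+1] arguments form [bdiff (G j)], which [G_cocycle] exchanges
    for the two outer terms of [G]. The right one is the head product that [bdiff (K (c + j))] still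
    lacks. The left one, with places moved by [dg a], is the sum that is left over. *)
Lemma bdiff_insert_first l c K a s :
  (forall c, multilinear l.+1 (K c)) -> size s = (n + l)%N ->
  bdiff mulX (insert_first c K) (a :: s)
  = - (-1) ^+ n *: insert_first c (fun c => bdiff mul (K c)) (a :: s)
    - \sum_(0 <= j < N) K (c + dg a + j)%N
        (mul (vl a) (G j (map vl (take n s))) :: map vl (drop n s)).
Proof.
move=> Kl ss; rewrite bdiff_sum.
set S := map vl (a :: s); have sS : size S = (n + l).+1 by rewrite /= size_map ss.
pose v := map vl (take n s); pose w := map vl (drop n s).
have sv : size v = n by rewrite size_map size_takel // ss leq_addr.
have sw : size w = l by rewrite size_map size_drop ss addKn.
have KB (c' : nat) x y : K c' (x - y :: w) = K c' (x :: w) - K c' (y :: w).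
  have := Kl c' [::] w y x (-1); rewrite /= !scaleN1r addrC => -> //.
    by rewrite addrC.
  by rewrite sw.
have K0 (c' : nat) : K c' (0 :: w) = 0 by rewrite -[X in X :: _](subrr 0) KB subrr.
have K1 (c' : nat) x b : K c' (b *: x :: w) = b *: K c' (x :: w).
  by have := Kl c' [::] w x 0 b; rewrite /= !addr0 K0 addr0 => -> //; rewrite sw.
pose y := last (vl a) v; pose u := belast (vl a) v.
have SE : S = u ++ y :: w.
  by rewrite -cat_rcons -lastI cat_cons -map_cat cat_take_drop.
have su : size u = n by rewrite size_belast.
(* The leftover sum is shifted back, so that both sides can be compared term by term at the same
   place [j] of [G]. *)
rewrite -(@big_nat_shift _ N c (dg a) (fun c' j => K c' (mul (vl a) (G j v) :: w)));
  last by move=> c' j le_N; rewrite G_bounded.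
rewrite /insert_first scaler_sumr -sumrB.
apply: eq_bigr => j _.
have -> : bdiff mulX (fun t => K (c + j)%N (G j (map vl (take n t)) :: map vl (drop n t)))
      (a :: s)
    = bdiff mul (fun r => K (c + j)%N (G j (take n r) :: drop n r)) S.
  by rewrite -(bdiff_map _ _ vlM); apply: eq_bdiff => r _; rewrite map_take map_drop.
rewrite (bdiff_split mul (fun u w => K (c + j)%N (G j u :: w)));
  last by rewrite sS ltnS leq_addr.
have -> : map vl (take n (a :: s)) = u by rewrite map_take -/S SE take_size_cat.
have -> : map vl (drop n (a :: s)) = y :: w by rewrite map_drop -/S SE drop_size_cat.
have -> : take n S = u by rewrite SE take_size_cat.
have -> : drop n S = y :: w by rewrite SE drop_size_cat.
have -> : take n.+1 S = vl a :: v by rewrite SE -cat_rcons -lastI take_size_cat //= sv.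
have -> : drop n.+1 S = w by rewrite SE -cat_rcons -lastI drop_size_cat //= sv.
rewrite (@bdiff_morph _ _ mul _ (fun x => K (c + j)%N (x :: w))); last by move=> *; apply: KB.
rewrite bdiff_cons2.
have -> : bdiff mul (G j) (vl a :: v) = (-1) ^+ n *: rpart mul (G j) (vl a :: v)
   - (if (dg a <= j)%N then mul (vl a) (G (j - dg a) v) else 0).
  have := G_cocycle j a sv; move/eqP; rewrite -addrA addrC addr_eq0 => /eqP E.
  by rewrite -E [RHS]addrC subrK.
rewrite KB K1 scaleNr scalerBr scalerN opprB opprK.
rewrite addrAC [X in X - _]addrC.
by case: ifP => _; rewrite ?K0.
Qed.

Lemma eq_circle l c K K' s : size s = (n + l).-1 ->
  (forall c' r, (c <= c')%N -> size r = l -> K c' r = K' c' r) ->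
  circle l c K s = circle l c K' s.
Proof.
elim: l c K K' s => [|l IH] c K K' s // ss KK'; rewrite addnS /= in ss.
have IF : insert_first c K s = insert_first c K' s.
  apply: eq_bigr => j _; apply: KK'; first exact: leq_addr.
  by rewrite /= size_map size_drop ss addKn.
rewrite /= IF; congr (_ - _ *: _).
case: s ss {IF} => [//|a t] /= ss; apply: IH => [|c' r le_c sr].
  by rewrite -ss.
by apply: KK'; rewrite /= ?sr // (leq_trans (leq_addr _ _) le_c).
Qed.

Lemma circle_lin l c b K K' s :
  circle l c (fun c r => b *: K c r + K' c r) s
  = b *: circle l c K s + circle l c K' s.
Proof.
elim: l c K K' s => [|l IH] c K K' s /=; first by rewrite scaler0 addr0.
rewrite {1}/insert_first big_split /= -scaler_sumr.
case: s => [|a t]; last first.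
  rewrite (IH _ (fun c r => K c (vl a :: r)) (fun c r => K' c (vl a :: r))).
  by rewrite scalerDr scalerBr opprD addrACA !scalerA mulrC.
by rewrite !scaler0 !subr0.
Qed.

Lemma circleZ l c b K s :
  circle l c (fun c r => b *: K c r) s = b *: circle l c K s.
Proof.
elim: l c K s => [|l IH] c K s /=; first by rewrite scaler0.
rewrite /insert_first -scaler_sumr scalerBr !scalerA mulrC -scalerA.
case: s => [|a t]; last by rewrite (IH _ (fun c r => K c (vl a :: r))) scalerA.
by rewrite !scaler0.
Qed.

Lemma circle_mull l c z K s :
  circle l c (fun c r => mul z (K c r)) s = mul z (circle l c K s).
Proof.
elim: l c K s => [|l IH] c K s /=; first by rewrite (amul0r mul_linr).
rewrite (amulBr mul_linr) (amulZr mul_linr) (amul_sumr mul_linr).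
case: s => [|a t]; last by rewrite (IH _ (fun c r => K c (vl a :: r))).
by rewrite (amul0r mul_linr).
Qed.

Lemma circle_shift l c d K s :
  circle l (c + d) (fun c r => K (c - d)%N r) s = circle l c K s.
Proof.
elim: l c K s => [|l IH] c K s //=; congr (_ - _ *: _).
  by apply: eq_bigr => j _; rewrite addnAC addnK.
case: s => [//|a t].
by rewrite addnAC (IH _ (fun c r => K c (vl a :: r))).
Qed.

(** What [bdiff_insert_first] leaves over for one insertion is the head product of [bdiff (K c)] for
    the insertion one argument later; the place [c + dg a + j] is the same in both. *)
Lemma bdiff_circle l c K s : (forall c, multilinear l (K c)) -> size s = (n + l)%N ->
  bdiff mulX (circle l c K) s
  = - (-1) ^+ n *: circle l.+1 c (fun c => bdiff mul (K c)) s.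
Proof.
elim: l c K s => [|l IH] c K s Kl ss.
  rewrite bdiff_eq0 //= /insert_first big1 ?sub0r => [|j _].
    by case: (s) => [|a t]; rewrite scaler0 oppr0 scaler0.
  by rewrite drop_oversize // ss addn0.
case: s ss => [|a [|b t]]; [by rewrite addnS| |]; rewrite addnS => -[ss].
  by move: n_gt0; rewrite -(ltn_add2r l) -ss.
pose Ka c r := K c (vl a :: r).
(* On arguments headed by [vl a], [bdiff (K c)] consists of its head product [K1] and of
   [bdiff (Ka c)]. Inserting [G] into [K1] gives [P] at the first argument and [Z] at later ones;
   [Y] comes from [Ka]. *)
pose K1 c r := if r is z :: r' then K c (mul (vl a) z :: r') else 0.
pose Z := circle l (c + dg a + dg b) (fun c r => K c (mul (vl a) (vl b) :: r)) t.
pose P := insert_first (c + dg a) K1 (b :: t).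
pose Y := circle l.+1 (c + dg a) (fun c => bdiff mul (Ka c)) (b :: t).
have EE (x : M) : (-1) ^+ n *: ((-1) ^+ n *: x) = x by rewrite signrZK.
have K1E : circle l.+1 (c + dg a) K1 (b :: t) = P - (-1) ^+ n *: Z.
  by rewrite circle_cons.
have RE : circle l.+1 (c + dg a) (fun c r => bdiff mul (K c) (vl a :: r)) (b :: t)
    = - Y - (P - (-1) ^+ n *: Z).
  rewrite -K1E -!scaleN1r.
  rewrite (@eq_circle _ _ _ (fun c r => -1 *: bdiff mul (Ka c) r + -1 *: K1 c r)).
  - by rewrite (circle_lin _ _ _ (fun c => bdiff mul (Ka c))) circleZ.
  - by rewrite addnS /= ss.
  move=> c' [|z r] _ //= [sr]; rewrite bdiff_cons2 !scaleN1r addrC.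
  by [].
have IHY : bdiff mulX (circle l (c + dg a) Ka) (b :: t) = - (-1) ^+ n *: Y.
  by apply: IH => // c'; apply: multilinear_cons.
rewrite circle_cons RE -[LHS]/(bdiff mulX
  (fun s => insert_first c K s - (-1) ^+ n *: (if s is a :: t
    then circle l (c + dg a) (fun c r => K c (vl a :: r)) t else 0)) [:: a, b & t]).
rewrite bdiffB (@bdiff_insert_first l) // bdiffZ [X in _ - _ *: X]bdiff_cons2.
rewrite dgM vlM addnA -/Z -[X in _ - X - _]/P -/Ka [bdiff mulX _ (b :: t)]IHY.
clearbody P Y Z; rewrite !scaleNr !scalerBr !scalerN !EE !opprK.
rewrite !opprD !opprK -!addrA; congr (_ + _).
by rewrite addrA addrC.
Qed.

Definition total_degree s := sumn (map dg s).

(** The cup product in disguise, split by the place [j] of the second factor. The first factor is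
    taken before a letter that lies beyond its own word, so for [c = 0] nothing of it is cut off. *)
Definition cut_sum l c K s : M := \sum_(0 <= j < N)
  mul (K (c + total_degree (take l s) + j)%N (map vl (take l s)))
      (G j (map vl (drop l s))).

(** In all insertions but the last, [rpart] splits off [z]. In the last one it splits off the output
    of [G], which yields the cut sum. *)
Lemma circle_rpart l c K s z : (size s).+1 = (n + l)%N ->
  circle l.+1 c (fun c r => rpart mul (K c) r) (rcons s z)
  = mul (circle l c K s) (vl z) + (- (-1) ^+ n) ^+ l *: cut_sum l c K (rcons s z).
Proof.
elim: l c K s => [|l IH] c K s ss.
  rewrite /= (amul0l mul_linl) add0r expr0 scale1r.
  rewrite (_ : (if _ is a :: t then _ else _) = 0); last by case: (rcons s z).
  rewrite scaler0 subr0 /insert_first /cut_sum take0 drop0.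
  apply: eq_bigr => j _; rewrite drop_oversize ?take_oversize ?size_rcons ?ss ?addn0 //=.
case: s ss => [|a s]; rewrite addnS => -[ss].
  by move: n_gt0; rewrite -(ltn_add2r l) -ss.
rewrite rcons_cons circle_cons (amulBl mul_linl) (amulZl mul_linl).
rewrite (@eq_circle _ _ _ (fun c r => rpart mul (fun r => K c (vl a :: r)) r)); first last.
- by move=> c' [|y r].
- by rewrite size_rcons addnS /= -ss.
rewrite (IH _ (fun c r => K c (vl a :: r))) // scalerDr opprD addrA.
congr (_ - _ + _).
  rewrite (amul_suml mul_linl); apply: eq_bigr => j _.
  have le_n : (n <= size (a :: s))%N by rewrite /= ss leq_addr.
  rewrite -rcons_cons drop_rcons // -{1}cats1 takel_cat // map_rcons.
  by rewrite -rcons_cons rpart_rcons.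
rewrite exprS -scalerA scaleNr; congr (- (_ *: (_ *: _))).
by rewrite /cut_sum /= /total_degree /= addnA.
Qed.

(** * The coboundary of the circle product *)

Section Homotopy.
Variables (m : nat) (F : nat -> seq M -> M).
Hypothesis m_gt0 : (0 < m)%N.
Hypothesis F_multilinear : forall c, multilinear m (F c).
Hypothesis F_cocycle : forall c a (s : seq M), size s = m ->
  mul (vl a) (F (c - dg a)%N s) + bdiff mul (F c) (vl a :: s)
  - (-1) ^+ m *: rpart mul (F c) (vl a :: s) = 0.
(** A cocycle identity with the output of [G j] in front and no left outer term: what acts before
    letter [j] does not get past that output. The missing term is the one that would produce the
    other cup product. *)
Hypothesis F_after_G : forall j (v s : seq M), size v = n -> size s = m ->
  bdiff mul (F j) (G j v :: s) = (-1) ^+ m *: rpart mul (F j) (G j v :: s).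

(** [bdiff_circle] reduces the claim to the inner differential of [F], which the cocycle identities
    turn into outer terms. Left ones occur only for insertions after the first argument and add up
    to [vl a] times the circle product; the right ones are collected by [circle_rpart]. *)
Lemma circle_homotopy a t : (size t).+1 = (n + m)%N ->
  mul (vl a) (circle m 0 F t) + bdiff mulX (circle m 0 F) (a :: t)
  + (-1) ^+ (n + m) *: mul (circle m 0 F (belast a t)) (vl (last a t))
  = - ((-1) ^+ n) ^+ m.+1 *: cut_sum m 0 F (a :: t).
Proof.
move=> st; rewrite (@bdiff_circle m) // circle_cons add0n.
have -> : insert_first 0 (fun c => bdiff mul (F c)) (a :: t)
    = (-1) ^+ m *: insert_first 0 (fun c => rpart mul (F c)) (a :: t).
  rewrite /insert_first scaler_sumr; apply: eq_bigr => j _; apply: F_after_G.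
    by rewrite size_map size_takel //= st leq_addr.
  by rewrite size_map size_drop /= st addKn.
have -> : circle m (dg a) (fun c r => bdiff mul (F c) (vl a :: r)) t
    = - mul (vl a) (circle m 0 F t)
      + (-1) ^+ m *: circle m (dg a) (fun c r => rpart mul (F c) (vl a :: r)) t.
  rewrite -circleZ -circle_mull -(circle_shift _ 0 (dg a)) add0n -scaleN1r -circle_lin.
  apply: eq_circle => [|c r _ sr]; first by rewrite -st.
  have := F_cocycle c a sr; move/eqP; rewrite -addrA addr_eq0 => /eqP ->.
  by rewrite scaleN1r opprK subrK.
have RE := circle_rpart 0 F (last a t); have := RE m (belast a t).
rewrite -lastI size_belast => /(_ st); rewrite circle_cons add0n.
set A := insert_first _ _ _; set B := circle _ _ _ _; set h1 := circle _ _ _ t.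
set h2 := circle _ _ _ (belast a t); set P := cut_sum _ _ _ _ => E.
have {}E : A = mul h2 (vl (last a t)) + (- (-1) ^+ n) ^+ m *: P + (-1) ^+ n *: B.
  by rewrite -E subrK.
clearbody A B h1 h2 P; rewrite {}E.
rewrite scaleNr scalerBr signrZK opprB !scalerDr !addrA subrr add0r.
have -> : (-1) ^+ n *: ((-1) ^+ m *: ((-1) ^+ n *: B)) = (-1) ^+ m *: B.
  by rewrite scalerA mulrC -scalerA signrZK.
have -> : (-1) ^+ n *: ((-1) ^+ m *: ((- (-1) ^+ n) ^+ m *: P))
    = ((-1) ^+ n) ^+ m.+1 *: P.
  rewrite !scalerA [(- _ ^+ n) ^+ m]exprNn exprS -mulrA [X in _ * X]mulrA -expr2 sqrr_sign.
  by rewrite mul1r.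
rewrite scalerA -exprD scaleNr [X in _ - X]addrC opprD addrA subrr sub0r.
by rewrite opprD addrAC addNr add0r.
Qed.
End Homotopy.

Hypothesis G_multilinear : forall j, multilinear n (G j).

(** [circle] depends on [a] through its degree as well as its value. A zero value makes the degree
    irrelevant, which is needed to pass from tuples over [X] to cochains on [M]. *)
Lemma circle_eq0 l c K u a v : (forall c, multilinear l (K c)) -> vl a = 0 ->
  (size u + size v).+2 = (n + l)%N -> circle l c K (u ++ a :: v) = 0.
Proof.
move=> + a0; elim: l c K u => [|l IH] c K u Kl suv //.
rewrite addnS in suv; case: suv => suv.
have -> : circle l.+1 c K (u ++ a :: v) = insert_first c K (u ++ a :: v)
    - (-1) ^+ n *: (if u ++ a :: v is b :: t
        then circle l (c + dg b) (fun c r => K c (vl b :: r)) t else 0) by [].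
rewrite [insert_first _ _ _]big1_seq ?sub0r => [|j _].
  case: u suv => [|b u] suv /=.
    rewrite (@eq_circle _ _ _ (fun _ _ => 0 *: (0 : M))).
    - by rewrite (circleZ _ _ 0 (fun _ _ => 0)) !scale0r scaler0 oppr0.
    - by rewrite -suv.
    move=> c' r _ sr; rewrite a0 scale0r (multilinear0 (u := [::]) (Kl c')) //=.
    by rewrite sr.
  rewrite (IH _ (fun c r => K c (vl b :: r))) ?scaler0 ?oppr0 //.
  by move=> c'; apply: multilinear_cons.
rewrite map_take map_drop map_cat /= a0.
have [lt_un|le_nu] := ltnP (size u) n.
  rewrite take_cat size_map ltnNge (ltnW lt_un) /= -(subnSK lt_un) /=.
  rewrite (multilinear0 (G_multilinear _)).
    rewrite (multilinear0 (u := [::]) (Kl _)) //= size_drop size_cat /= !size_map addnS.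
    by rewrite suv addKn.
  rewrite size_map size_takel ?size_map; first by rewrite -addSn subnKC.
  by rewrite leq_subLR addSn suv leq_addr.
have -> : drop n (map vl u ++ 0 :: map vl v) = drop n (map vl u) ++ 0 :: map vl v.
  rewrite drop_cat size_map; case: ltnP => // le_un.
  have eu : size u = n by apply/eqP; rewrite eqn_leq le_nu le_un.
  by rewrite -eu subnn drop0 -(size_map vl u) drop_size.
move: suv; rewrite -{1}(subnKC le_nu) -addnA -addnS => /addnI suv.
by rewrite -cat_cons (multilinear0 (Kl _)) //= size_drop !size_map -suv addSn.
Qed.

End CircleProduct.

(** * The monomial algebra *)

Section PathAlgebra.
Variables (k : fieldType) (V E : finType) (src tgt : E -> V) (rels : seq (seq E)).
Notation P := (V * seq E)%type.
Notation B := (@mbasis V E src tgt rels).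
Notation M := (malg src tgt rels k).
Notation mul := (@malg_mul V E src tgt rels k).
Notation target := (path_end tgt).
Implicit Types (p q : P) (v : V) (a b w : seq E) (c : nat) (x y z : M).

Definition is_basis p := p \in basis_list src tgt rels.

Lemma target_cat v a b : target (v, a ++ b) = target (target (v, a), b).
Proof. by rewrite /path_end /= map_cat last_cat. Qed.

Lemma valid_path_cons v d a :
  valid_path src tgt (v, d :: a) = (src d == v) && valid_path src tgt (tgt d, a).
Proof. by case: a => [|d1 a] //; rewrite /valid_path /= [tgt d == _]eq_sym. Qed.

Lemma valid_path_cat v a b :
  valid_path src tgt (v, a ++ b)
  = valid_path src tgt (v, a) && valid_path src tgt (target (v, a), b).
Proof.
elim: a v => [|d a IH] v //.
by rewrite cat_cons !valid_path_cons IH andbA.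
Qed.

Lemma is_basisE p : is_basis p = [&& valid_path src tgt p,
  ~~ has (fun s : seq E => infix s p.2) rels & (size p.2 < #|V|)%N].
Proof.
rewrite /is_basis mem_filter /nonzero_path -andbA; congr [&& _, _ & _].
apply/allpairsP/idP => [[[v w] /= [_ ws ->]]|ps].
  case/flattenP: ws => s /mapP[l]; rewrite mem_iota add0n => /andP[_ lt_l] ->.
  by case/mapP => t _ -> /=; rewrite size_tuple.
exists p => /=; split; [by rewrite mem_enum | | by case: (p)].
apply/flattenP; exists [seq val t | t : (size p.2).-tuple E].
  by apply/mapP; exists (size p.2) => //; rewrite mem_iota.
by apply/mapP; exists (in_tuple p.2); rewrite ?mem_enum.
Qed.

Lemma is_basis_cat v a b :
  is_basis (v, a ++ b) -> is_basis (v, a) /\ is_basis (target (v, a), b).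
Proof.
rewrite !is_basisE valid_path_cat /= size_cat => /and3P[/andP[-> ->] nr lt_ab].
rewrite (leq_ltn_trans (leq_addr _ _) lt_ab) (leq_ltn_trans (leq_addl _ _) lt_ab).
rewrite !andbT; split; apply: contra nr => /hasP[r rr ri]; apply/hasP; exists r => //.
  exact: infix_catr.
exact: infix_catl.
Qed.

Lemma is_basis_val (t : B) : is_basis (val t).
Proof. exact: valP. Qed.

Lemma is_basisP p : reflect (exists t : B, p = val t) (is_basis p).
Proof.
apply: (iffP idP) => [pB|[t ->]]; last exact: is_basis_val.
by exists (SeqSub pB).
Qed.

(** Defined for every pair, with value 0 outside the basis, so that products falling into the ideal
    need no separate case. [pcoef] follows the same convention. *)
Definition path_vec p : M := [ffun t => (val t == p)%:R].

Definition pcoef x p : k := \sum_(t : B | val t == p) x t.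

Lemma pcoef_val x (t : B) : pcoef x (val t) = x t.
Proof. by rewrite /pcoef (big_pred1 t) // => t'; rewrite val_eqE. Qed.

Lemma path_vec_nbasis p : ~~ is_basis p -> path_vec p = 0.
Proof.
move=> np; apply/ffunP => t; rewrite !ffunE; case: eqP => // tp.
by rewrite -tp is_basis_val in np.
Qed.

Lemma pcoefD x y p : pcoef (x + y) p = pcoef x p + pcoef y p.
Proof. by rewrite /pcoef -big_split; apply: eq_bigr => t _; rewrite ffunE. Qed.

Lemma pcoefN x p : pcoef (- x) p = - pcoef x p.
Proof. by rewrite /pcoef -sumrN; apply: eq_bigr => t _; rewrite ffunE. Qed.

Lemma pcoefB x y p : pcoef (x - y) p = pcoef x p - pcoef y p.
Proof. by rewrite pcoefD pcoefN. Qed.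

Lemma pcoefZ (l : k) x p : pcoef (l *: x) p = l * pcoef x p.
Proof. by rewrite /pcoef mulr_sumr; apply: eq_bigr => t _; rewrite ffunE. Qed.

Lemma pcoef0 p : pcoef 0 p = 0.
Proof. by rewrite /pcoef big1 // => t _; rewrite ffunE. Qed.

Lemma pcoef_sum (I : Type) (l : seq I) (Q : pred I) (F : I -> M) p :
  pcoef (\sum_(i <- l | Q i) F i) p = \sum_(i <- l | Q i) pcoef (F i) p.
Proof.
by apply: (big_morph (fun x => pcoef x p)) => [? ?|]; rewrite ?pcoefD ?pcoef0.
Qed.

Lemma pcoefP x y : (forall p, is_basis p -> pcoef x p = pcoef y p) -> x = y.
Proof. by move=> xy; apply/ffunP => t; rewrite -!pcoef_val xy ?is_basis_val. Qed.

Lemma decompose x : x = \sum_(t : B) x t *: path_vec (val t).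
Proof.
apply/ffunP => t; rewrite sum_ffunE (bigD1 t) //= !ffunE eqxx.
rewrite big1 ?addr0 => [|t' nt]; first by rewrite [RHS]mulr1.
by rewrite !ffunE val_eqE eq_sym (negPf nt) [LHS]mulr0.
Qed.

Lemma malg_mul_linl (l : k) x y z : mul (l *: x + y) z = l *: mul x z + mul y z.
Proof.
apply/ffunP => t; rewrite !ffunE scaler_sumr -big_split; apply: eq_bigr => b1 _.
rewrite scaler_sumr -big_split; apply: eq_bigr => b2 _ /=.
by case: ifP => _; rewrite ?scaler0 ?addr0 // !ffunE mulrDl -mulrA.
Qed.

Lemma malg_mul_linr (l : k) x y z : mul z (l *: x + y) = l *: mul z x + mul z y.
Proof.
apply/ffunP => t; rewrite !ffunE scaler_sumr -big_split; apply: eq_bigr => b1 _.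
rewrite scaler_sumr -big_split; apply: eq_bigr => b2 _ /=.
by case: ifP => _; rewrite ?scaler0 ?addr0 // !ffunE mulrDr mulrCA.
Qed.

Lemma concat_pathE p q v b : (concat_path tgt p q == Some (v, b))
  = [&& v == p.1, take (size p.2) b == p.2 & q == (target p, drop (size p.2) b)].
Proof.
case: p => v0 a; case: q => v1 c; rewrite /concat_path /=.
apply/idP/and3P => [|[/eqP-> /eqP ta /eqP[-> ->]]].
  case: ifP => // /eqP <- /eqP; case=> <- <-; rewrite eqxx take_size_cat ?drop_size_cat //.
by rewrite eqxx -{1}ta cat_take_drop.
Qed.

Lemma concat_pathEr p q v b : (concat_path tgt p q == Some (v, b))
  = [&& drop (size b - size q.2) b == q.2,
        target (v, take (size b - size q.2) b) == q.1
      & p == (v, take (size b - size q.2) b)].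
Proof.
case: p => v0 a; case: q => v1 c; rewrite /concat_path /=.
apply/idP/and3P => [|[/eqP dc /eqP <- /eqP[-> ->]]].
  case: ifP => // /eqP tv /eqP; case=> <- <-; rewrite size_cat addnK.
  by rewrite take_size_cat ?drop_size_cat // tv.
by rewrite eqxx -{2}dc cat_take_drop.
Qed.

Lemma pcoef_path_mul p x v b : is_basis (v, b) ->
  pcoef (mul (path_vec p) x) (v, b)
  = if (v == p.1) && (take (size p.2) b == p.2)
    then pcoef x (target p, drop (size p.2) b) else 0.
Proof.
move=> vB; have [t tE] := is_basisP _ vB; rewrite {1}tE pcoef_val ffunE.
have [/is_basisP[p' pE]|np] := boolP (is_basis p); last first.
  rewrite path_vec_nbasis // big1 => [|b1 _].
    case: ifP => // /andP[/eqP vE /eqP bE]; case/negP: np.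
    by move: vB; rewrite -(cat_take_drop (size p.2) b) bE vE => /is_basis_cat[]; case: (p).
  by rewrite big1 // => b2 _; rewrite ffunE mul0r if_same.
rewrite (bigD1 p') //= [X in _ + X]big1 ?addr0 => [|b1 nb1]; last first.
  by rewrite big1 // => b2 _; rewrite ffunE pE val_eqE (negPf nb1) mul0r if_same.
rewrite -tE -pE; under eq_bigr do rewrite concat_pathE ffunE -pE eqxx mul1r.
case: ifP => [/andP[-> ->]|nc]; first by rewrite -big_mkcond.
by rewrite big1 // => b2 _; rewrite andbA nc.
Qed.

Lemma pcoef_mul_path p x v b : is_basis (v, b) ->
  pcoef (mul x (path_vec p)) (v, b)
  = if (drop (size b - size p.2) b == p.2)
       && (target (v, take (size b - size p.2) b) == p.1)
    then pcoef x (v, take (size b - size p.2) b) else 0.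
Proof.
move=> vB; have [t tE] := is_basisP _ vB; rewrite {1}tE pcoef_val ffunE exchange_big /=.
have [/is_basisP[p' pE]|np] := boolP (is_basis p); last first.
  rewrite path_vec_nbasis // big1 => [|b1 _].
    case: ifP => // /andP[/eqP bE /eqP vE]; case/negP: np.
    move: vB; rewrite -{1}(cat_take_drop (size b - size p.2) b) bE => /is_basis_cat[_].
    by rewrite vE; case: (p).
  by rewrite big1 // => b2 _; rewrite ffunE mulr0 if_same.
rewrite (bigD1 p') //= [X in _ + X]big1 ?addr0 => [|b1 nb1]; last first.
  by rewrite big1 // => b2 _; rewrite [path_vec _ _]ffunE pE val_eqE (negPf nb1) mulr0 if_same.
rewrite -tE -pE; under eq_bigr do rewrite concat_pathEr [path_vec _ _]ffunE -pE eqxx mulr1.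
case: ifP => [/andP[-> ->]|nc]; first by rewrite -big_mkcond.
by rewrite big1 // => b2 _; rewrite andbA nc.
Qed.

Lemma pcoef_path_vec p q : is_basis p -> pcoef (path_vec q) p = (p == q)%:R.
Proof. by case/is_basisP => t ->; rewrite pcoef_val ffunE. Qed.

Lemma path_vec_mul p q : mul (path_vec p) (path_vec q)
  = if target p == q.1 then path_vec (p.1, p.2 ++ q.2) else 0.
Proof.
apply: pcoefP => -[v b] vB; rewrite pcoef_path_mul //.
have hq : (v == p.1) && (take (size p.2) b == p.2) ->
    pcoef (path_vec q) (target p, drop (size p.2) b)
    = ((target p, drop (size p.2) b) == q)%:R.
  case/andP => /eqP vE /eqP bE; apply: pcoef_path_vec; move: vB.
  rewrite -{1}(cat_take_drop (size p.2) b) bE vE => /is_basis_cat[_].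
  by case: (p).
case: ifP => [/[dup] c /hq -> | nc].
  case/andP: c => /eqP vE /eqP bE; case: (target p =P q.1) => tq; last first.
    by rewrite pcoef0; case: eqP => // qE; case: tq; rewrite -qE.
  rewrite pcoef_path_vec // vE xpair_eqE eqxx -[b in RHS](cat_take_drop (size p.2)).
  rewrite bE eqseq_cat // eqxx /= tq; case: (q) => q1 q2.
  by rewrite xpair_eqE eqxx.
case: ifP => _; rewrite ?pcoef0 // pcoef_path_vec //.
by case: eqP => // -[vE bE]; move: nc; rewrite vE bE take_size_cat // !eqxx.
Qed.

Lemma malg_mulA : associative mul.
Proof.
have lin := malg_mul_linl; have linr := malg_mul_linr.
move=> x y z; rewrite (decompose x) !(amul_suml lin); apply: eq_bigr => t _.
rewrite !(amulZl lin); congr (_ *: _).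
rewrite (decompose y) !((amul_suml lin), (amul_sumr linr)); apply: eq_bigr => t' _.
rewrite !((amulZl lin), (amulZr linr)); congr (_ *: _).
rewrite (decompose z) !(amul_sumr linr); apply: eq_bigr => t'' _.
rewrite !(amulZr linr); congr (_ *: _); rewrite !path_vec_mul.
move: (val t) (val t') (val t'') => [v1 a1] [v2 a2] [v3 a3] /=.
have [e1|n1] := eqVneq (target (v1, a1)) v2; last first.
  rewrite (amul0l lin); case: ifP => _; rewrite ?(amul0r linr) // path_vec_mul /=.
  by rewrite (negPf n1).
rewrite path_vec_mul /= target_cat e1; case: ifP => _; rewrite ?(amul0r linr) //.
by rewrite path_vec_mul /= e1 eqxx catA.
Qed.

Definition idem v : M := path_vec (v, [::]).

Lemma idem_orth u v : mul (idem u) (idem v) = if u == v then idem u else 0.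
Proof. exact: path_vec_mul. Qed.

Lemma malg_mul1l x : mul (\sum_v idem v) x = x.
Proof.
apply: pcoefP => -[v b] vB; rewrite (amul_suml malg_mul_linl).
rewrite pcoef_sum.
rewrite (bigD1 v) //= pcoef_path_mul //= eqxx take0 drop0 big1 ?addr0 // => u nu.
by rewrite pcoef_path_mul //= eq_sym (negPf nu).
Qed.

Lemma malg_mul1r x : mul x (\sum_v idem v) = x.
Proof.
apply: pcoefP => -[v b] vB; rewrite (amul_sumr malg_mul_linr).
rewrite pcoef_sum.
rewrite (bigD1 (target (v, b))) //= pcoef_mul_path //= subn0 take_size drop_size !eqxx /=.
rewrite big1 ?addr0 // => u nu.
by rewrite pcoef_mul_path //= subn0 take_size [_ == u]eq_sym (negPf nu) andbF.
Qed.

Lemma idem_path p : mul (idem p.1) (path_vec p) = path_vec p.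
Proof. by rewrite path_vec_mul /= eqxx -surjective_pairing. Qed.

Lemma path_idem p : mul (path_vec p) (idem (target p)) = path_vec p.
Proof. by rewrite path_vec_mul /= eqxx cats0 -surjective_pairing. Qed.

Lemma idem_path_eq0 v p : v != p.1 -> mul (idem v) (path_vec p) = 0.
Proof. by move=> vp; rewrite path_vec_mul /= (negPf vp). Qed.

(** * Cochains on tuples of paths *)

Definition word (qs : seq P) := flatten [seq q.2 | q <- qs].
Definition vecs (qs : seq P) := [seq path_vec q | q <- qs].

Fixpoint ext (H : seq B -> M) (s : seq M) : M :=
  if s is x :: t then \sum_(b : B) x b *: ext (fun ts => H (b :: ts)) t else H [::].

Lemma ext_multilinear n H : multilinear n (ext H).
Proof.
move=> u; elim: u n H => [|x u IH] n H v y z l suv /=.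
  rewrite scaler_sumr -big_split; apply: eq_bigr => b _ /=.
  by rewrite !ffunE scalerDl scalerA.
case: n suv => [//|n] [suv]; rewrite scaler_sumr -big_split; apply: eq_bigr => b _ /=.
by rewrite (IH n) // scalerDr !scalerA mulrC.
Qed.

Lemma ext_path H (t : B) s :
  ext H (path_vec (val t) :: s) = ext (fun ts => H (t :: ts)) s.
Proof.
rewrite /= (bigD1 t) //= ffunE eqxx scale1r big1 ?addr0 // => b nb.
by rewrite ffunE val_eqE (negPf nb) scale0r.
Qed.

Lemma ext_paths (H : seq P -> M) qs :
  ext (fun ts => H (map val ts)) (vecs qs) = if all is_basis qs then H qs else 0.
Proof.
elim: qs H => [|q qs IH] H //; rewrite -[vecs _]/(path_vec q :: vecs qs).
rewrite [all _ _]/=; have [/is_basisP[t ->]|nq] := boolP (is_basis q).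
  rewrite ext_path andTb. exact: (IH (fun r => H (val t :: r))).
by rewrite path_vec_nbasis //= big1 // => b _; rewrite ffunE scale0r.
Qed.

Lemma paths_eq0 n (Phi : seq M -> M) : multilinear n Phi ->
  (forall ts : seq B, size ts = n -> Phi (vecs (map val ts)) = 0) ->
  forall s, size s = n -> Phi s = 0.
Proof.
elim: n Phi => [|n IH] Phi Phil Phi0 [|x s] //.
  by move=> _; apply: (Phi0 [::]).
move=> -[ss].
rewrite (decompose x) -[LHS]/(Phi ([::] ++ _ :: s)) (multilinear_suml _ _ _ Phil) /= ?ss //.
rewrite big1 // => t _; have := Phil [::] s (path_vec (val t)) 0 (x t).
rewrite /= addr0 => -> /=; last by rewrite ss.
rewrite (multilinear0 (u := [::]) Phil) /= ?ss // addr0.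
rewrite (IH (fun s => Phi (path_vec (val t) :: s))) ?scaler0 //.
  exact: multilinear_cons.
by move=> ts sts; apply: (Phi0 (t :: ts)); rewrite /= sts.
Qed.

Definition kills_zero (W : zmodType) n (alpha : seq M -> W) :=
  forall s t, (size s + size t).+1 = n -> alpha (s ++ 0 :: t) = 0.

(** Multiplying neighbours changes neither the start nor the concatenated word, and non-composable
    neighbours give 0. Hence agreement on tuples with this start and this word is enough. *)
Lemma eq_bdiff_paths (W : zmodType) (alpha beta : seq M -> W) n v w p ps :
  kills_zero n alpha -> kills_zero n beta ->
  (forall q qs, (size qs).+1 = n -> q.1 = v -> word (q :: qs) = w ->
    alpha (vecs (q :: qs)) = beta (vecs (q :: qs))) ->
  size ps = n -> p.1 = v -> word (p :: ps) = w ->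
  bdiff mul alpha (vecs (p :: ps)) = bdiff mul beta (vecs (p :: ps)).
Proof.
elim: ps n alpha beta v w p => [|q ps IH] n alpha beta v w p a0 b0 ab sn pv pw.
  by rewrite !bdiff_small.
case: n sn a0 b0 ab => [//|n] [sn] a0 b0 ab.
rewrite -[vecs _]/(path_vec p :: path_vec q :: vecs ps) !bdiff_cons2; congr (- _ - _).
  rewrite path_vec_mul; case: eqP => pq.
    apply: (ab (p.1, p.2 ++ q.2) ps); rewrite /= ?sn //.
    by rewrite -pw /word /= catA.
  by rewrite (a0 [::]) ?(b0 [::]) //= size_map sn.
apply: (IH n _ _ q.1 (word (q :: ps))) => // [s t st|s t st|r qs sq qr rw].
- by apply: (a0 (path_vec p :: s)); rewrite /= -st.
- by apply: (b0 (path_vec p :: s)); rewrite /= -st.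
apply: (ab p (r :: qs)); rewrite /= ?sq //.
by rewrite -pw /word /=; congr (_ ++ _).
Qed.

Lemma bdiff_coef (F : seq M -> M) s p :
  bdiff mul (fun t => pcoef (F t) p) s = pcoef (bdiff mul F s) p.
Proof. by apply: (bdiff_morph mul (L := pcoef^~ p)) => x y; rewrite pcoefB. Qed.

Lemma kills_zero_coef n (F : seq M -> M) p :
  multilinear n F -> kills_zero n (fun t => pcoef (F t) p).
Proof. by move=> Fl s t st; rewrite (multilinear0 Fl) ?pcoef0. Qed.

Lemma dropl_cat (A : Type) c (s t : seq A) : (c <= size s)%N ->
  drop c (s ++ t) = drop c s ++ t.
Proof. by elim: s c => [|x s IH] [|c] //=; [rewrite drop0 | exact: IH]. Qed.

(** As neither of [a], [b] is a prefix of the other, they differ before either ends, and what is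
    appended cannot matter. *)
Lemma eq_take_cat c a b a' b' : ~~ prefix a b -> ~~ prefix b a ->
  (take c (a ++ a') == take c (b ++ b')) = (take c a == take c b).
Proof.
elim: a b c => [|x a IH] [|y b] [|c] //= nab nba; rewrite !eqseq_cons.
by case: eqP nab nba => [->|] //=; rewrite eqxx => nab nba; rewrite IH.
Qed.

(** * Support of normalised cocycles *)

Section Support.
Variables (m : nat) (f : seq M -> M).
Hypothesis f_multilinear : multilinear m.+1 f.
Hypothesis f_cocycle : cocycle mul m.+1 f.
Hypothesis f_normal : normal idem m.+1 f.

Lemma support_basis qs : size qs = m.+1 -> f (vecs qs) != 0 -> all is_basis qs.
Proof.
move=> sq; apply: contraNT => /allPn[q qqs nq].
move: sq; case/path.splitPr: qqs => u w sq.
rewrite /vecs map_cat /= (path_vec_nbasis nq) (multilinear0 f_multilinear) //.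
by rewrite !size_map -sq size_cat /= addnS.
Qed.

(** The idempotent at the start of the first path can be split off it and, by [normal_head],
    multiplied onto the value. *)
Lemma support_start q qs v b : size qs = m -> is_basis (v, b) ->
  pcoef (f (vecs (q :: qs))) (v, b) != 0 -> v = q.1.
Proof.
move=> sq vB; apply: contraNeq => vq; rewrite /vecs /= -idem_path.
rewrite -(normal_head malg_mul_linl f_cocycle f_normal).
  by rewrite pcoef_path_mul //= (negPf vq).
by rewrite size_map.
Qed.

Lemma support_end q qs v b : size qs = m -> is_basis (v, b) ->
  pcoef (f (vecs (rcons qs q))) (v, b) != 0 -> target (v, b) = target q.
Proof.
move=> sq vB; apply: contraNeq => vq; rewrite /vecs map_rcons -path_idem.
rewrite -(normal_last malg_mul_linr f_cocycle f_normal).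
  by rewrite pcoef_mul_path //= subn0 take_size (negPf vq) andbF.
by rewrite size_map.
Qed.

(** The idempotent at the end of one path passes, by [normal_balanced], to the next path and kills
    it unless that path starts there. *)
Lemma support_composable u q qs : (size u + size qs).+1 = m.+1 ->
  f (vecs (u ++ q :: qs)) != 0 -> path (fun p r : P => target p == r.1) q qs.
Proof.
elim: qs u q => [|r qs IH] u q //= sq f0; rewrite -cat_rcons in f0.
rewrite (IH (rcons u q)) //; last by rewrite size_rcons -sq addSn addnS.
rewrite andbT; apply: contraNT f0 => qr; rewrite cat_rcons /vecs map_cat /= -path_idem.
rewrite (normal_balanced malg_mul_linl malg_mul_linr f_cocycle f_normal).
  by rewrite idem_path_eq0 // -cat_rcons (multilinear0 f_multilinear) //
    size_rcons !size_map addSn -addnS.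
by rewrite !size_map -sq addnS.
Qed.

Hypothesis Q_triangular : triangular src tgt.

Lemma composable_word q qs : path (fun p r : P => target p == r.1) q qs ->
  all is_basis (q :: qs) ->
  valid_path src tgt (q.1, word (q :: qs))
  /\ target (q.1, word (q :: qs)) = target (last q qs).
Proof.
elim: qs q => [|r qs IH] q /=.
  by rewrite /word /= cats0 -surjective_pairing andbT is_basisE => _ /and3P[].
case/andP => /eqP qr /IH{}IH /andP[qB rB]; have [v_r t_r] := IH rB.
rewrite /word /= valid_path_cat target_cat -surjective_pairing qr v_r t_r.
by move: qB; rewrite is_basisE => /and3P[-> _ _].
Qed.

Lemma closed_path_trivial v a : valid_path src tgt (v, a) -> target (v, a) = v -> a = [::].
Proof.
move=> va ta; case: a va ta => // d a va ta.
by have := Q_triangular va isT; rewrite ta eqxx.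
Qed.

(** The word and the value are parallel paths. If one were a prefix of the other, the remainder
    would be a closed path, which is trivial in a triangular quiver. *)
Lemma support_word qs v b : size qs = m.+1 -> is_basis (v, b) ->
  pcoef (f (vecs qs)) (v, b) != 0 -> word qs != b ->
  ~~ prefix (word qs) b && ~~ prefix b (word qs).
Proof.
case: qs => [//|q qs] [sq] vB c0 wb.
have f0 : f (vecs (q :: qs)) != 0.
  by apply: contraNneq c0 => ->; rewrite pcoef0.
have qsB := @support_basis (q :: qs) (congr1 S sq) f0.
have comp : path (fun p r : P => target p == r.1) q qs.
  by apply: (@support_composable [::]); rewrite //= sq.
have [vw tw] := composable_word comp qsB.
have vE := support_start sq vB c0; rewrite -vE in vw tw.
have tE : target (v, b) = target (v, word (q :: qs)).
  by rewrite tw; apply: (@support_end _ (belast q qs)); rewrite ?size_belast // -lastI.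
have vb : valid_path src tgt (v, b) by move: vB; rewrite is_basisE => /and3P[].
move: (word (q :: qs)) wb vw tE {tw} => W wb vw tE.
apply/andP; split; apply: contra wb => /prefixP[c cE]; move: vw vb tE; rewrite cE.
  rewrite valid_path_cat target_cat => _ /andP[_ vc] /(closed_path_trivial vc) ->.
  by rewrite cats0.
rewrite valid_path_cat target_cat => /andP[_ vc] _ /esym /(closed_path_trivial vc) ->.
by rewrite cats0.
Qed.

(** * Splitting a normalised cocycle by place *)

Definition path_tail c p : P := (target (p.1, take c p.2), drop c p.2).

(* The part of [f] acting before letter [c].  If the word differs from [u.2], the place is
   the first letter where they differ.  If they agree, the first argument [q] acts at
   each of its letters [j], by f (drop j q, ...) - f (drop j.+1 q, ...); the sum over
   j < c telescopes. *)
Definition located_coef c qs (u : P) : k :=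
  if word qs == u.2 then
    pcoef (f (vecs qs)) u
    - (if qs is q :: r then
         if (c <= size q.2)%N
         then pcoef (f (path_vec (path_tail c q) :: vecs r)) (path_tail c u) else 0
       else 0)
  else if take c (word qs) == take c u.2 then 0 else pcoef (f (vecs qs)) u.

Definition located c : seq M -> M :=
  ext (fun ts => [ffun t => located_coef c (map val ts) (val t)]).

Lemma located_multilinear c : multilinear m.+1 (located c).
Proof. exact: ext_multilinear. Qed.

Lemma pcoef_located c qs u : is_basis u ->
  pcoef (located c (vecs qs)) u = if all is_basis qs then located_coef c qs u else 0.
Proof.
case/is_basisP => t ->; rewrite pcoef_val /located.
rewrite (ext_paths (fun qs => [ffun t => located_coef c qs (val t)])).
by case: ifP => _; rewrite ffunE.
Qed.

Lemma path_tail0 p : path_tail 0 p = p.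
Proof. by case: p => v a; rewrite /path_tail /= take0 drop0. Qed.

Lemma f_idem v s : size s = m -> f (idem v :: s) = 0.
Proof. by move=> sm; apply: (f_normal (u := [::])); rewrite /= sm. Qed.

Lemma f_support_basis qs : size qs = m.+1 -> ~~ all is_basis qs -> f (vecs qs) = 0.
Proof. by move=> sq; apply: contraNeq; apply: support_basis. Qed.

Lemma located0 s : size s = m.+1 -> located 0 s = 0.
Proof.
move: s; apply: paths_eq0; first exact: located_multilinear.
case=> [//|t ts] [st]; apply: pcoefP => u uB; rewrite pcoef0 pcoef_located //.
case: ifP => // _; rewrite /located_coef !take0 eqxx; case: ifP => // _.
by rewrite /= !path_tail0 subrr.
Qed.

(** Off the diagonal, agreement of the first [c] letters would make one of the two words a prefix of
    the other, against [support_word]. On the diagonal a correction can only occur at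
    [c = size q.2]; its first argument is then a vertex, on which [f] vanishes. *)
Lemma located_large c qs u : size qs = m.+1 -> is_basis u ->
  (size u.2 <= c)%N || (size (word qs) <= c)%N ->
  pcoef (located c (vecs qs)) u = pcoef (f (vecs qs)) u.
Proof.
case: u => v b sq uB /= szc; rewrite pcoef_located //.
have [qB|nB] := boolP (all _ _); last by rewrite f_support_basis ?pcoef0.
rewrite /located_coef /=; case: eqP => [wb|/eqP wb]; last first.
  case: eqP => // tE; apply/esym/eqP; apply: contraNT wb => c0.
  rewrite -[_ == _]negbK; apply/negP => wb.
  have /andP[/negP nwb /negP nbw] := support_word sq uB c0 wb.
  case/orP: szc => szc; move: tE; rewrite (take_oversize szc) => tE.
    by apply: nbw; rewrite -tE; apply: prefix_take.
  by apply: nwb; rewrite tE; apply: prefix_take.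
have {}szc : (size b <= c)%N by rewrite wb orbb in szc.
case: qs sq wb {qB} => [//|q r] [sr] wb; case: ifP => [le_cq|]; last by rewrite subr0.
have cE : c = size q.2.
  apply/eqP; rewrite eqn_leq le_cq (leq_trans _ szc) // -wb /word /= size_cat.
  exact: leq_addr.
by rewrite {1}/path_tail cE drop_size f_idem ?size_map // pcoef0 subr0.
Qed.

Lemma located_start c q qs v b : size qs = m -> is_basis (v, b) ->
  v != q.1 -> pcoef (located c (vecs (q :: qs))) (v, b) = 0.
Proof.
move=> sq vB vq; rewrite pcoef_located //; case: ifP => //= /andP[qB _].
have f0 : pcoef (f (vecs (q :: qs))) (v, b) = 0.
  by apply/eqP; apply: contraNT vq => /(support_start sq vB)/eqP.
rewrite /located_coef f0 if_same; case: eqP => //= wb.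
case: ifP => [le_c|_]; last by rewrite subr0.
(* The correction cuts [q], so [support_start] does not apply to it. If [q] is trivial, its tail is
   a vertex; otherwise the common first letter of word and value forces equal starts. *)
case: q qB vq wb {f0} le_c => v' [|d a] qB vq wb le_c /=.
  by rewrite {1}/path_tail /= f_idem ?size_map // pcoef0 subr0.
move: vB qB; rewrite -wb /word /= !is_basisE /= !valid_path_cons.
by move=> /and3P[/andP[/eqP dv _] _ _] /and3P[/andP[/eqP dv' _] _ _];
  rewrite -dv dv' eqxx in vq.
Qed.

Lemma vecs_cons_rcons p qs q :
  vecs (p :: rcons qs q) = rcons (vecs (p :: qs)) (path_vec q).
Proof. by rewrite /vecs /= map_rcons. Qed.

Lemma located_cocycle_start c p qs v b : size qs = m.+1 -> is_basis (v, b) ->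
  v != p.1 ->
  pcoef (mul (path_vec p) (located (c - size p.2) (vecs qs))
        + bdiff mul (located c) (vecs (p :: qs))
        - (-1) ^+ m.+1 *: rpart mul (located c) (vecs (p :: qs))) (v, b) = 0.
Proof.
move=> sq vB vp; rewrite pcoefB pcoefD pcoefZ pcoef_path_mul // (negPf vp) andFb add0r.
rewrite -bdiff_coef (@eq_bdiff_paths _ _ (fun _ => 0) m.+1 p.1 (word (p :: qs))) //.
- rewrite bdiff_eq0 // add0r; case/lastP: qs sq => [//|qs q].
  rewrite size_rcons => -[sq]; rewrite vecs_cons_rcons rpart_rcons.
  rewrite pcoef_mul_path //; case: ifP => _; rewrite ?mulr0 ?oppr0 //.
  rewrite (located_start _ sq) ?mulr0 ?oppr0 //.
  by move: vB; rewrite -{1}(cat_take_drop (size b - size q.2) b) => /is_basis_cat[].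
- exact/kills_zero_coef/located_multilinear.
by move=> q r [sr] qp _; rewrite (located_start _ sr) // qp.
Qed.

(** Whether a term is kept depends only on the first [c] letters of the full word and of [b], so
    [sel] can be applied to the whole cocycle identity of [f]. Removing [p] in front lowers [c] by
    its length; removing the last path has no effect, by [support_word] and [eq_take_cat]. *)
Lemma located_cocycle_core c p qs v b : size qs = m.+1 -> is_basis (v, b) ->
  all is_basis (p :: qs) -> word (p :: qs) != b ->
  pcoef (mul (path_vec p) (located (c - size p.2) (vecs qs))
        + bdiff mul (located c) (vecs (p :: qs))
        - (-1) ^+ m.+1 *: rpart mul (located c) (vecs (p :: qs))) (v, b) = 0.
Proof.
move=> sq vB psB wb.
have [pB qsB] : is_basis p /\ all is_basis qs by apply/andP.
pose sel (l : k) := if take c (word (p :: qs)) == take c b then 0 else l.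
have selD l l' : sel (l + l') = sel l + sel l' by rewrite /sel; case: ifP; rewrite ?addr0.
have selM l l' : sel (l * l') = l * sel l' by rewrite /sel; case: ifP; rewrite ?mulr0.
have selN l : sel (- l) = - sel l by rewrite /sel; case: ifP; rewrite ?oppr0.
have sel0 : sel 0 = 0 by rewrite /sel if_same.
have fE : pcoef (lpart mul f (vecs (p :: qs)) + bdiff mul f (vecs (p :: qs))
        - (-1) ^+ m.+1 *: rpart mul f (vecs (p :: qs))) (v, b) = 0.
  by rewrite -hdiffE ?f_cocycle ?pcoef0 //= size_map sq.
rewrite -[RHS]sel0 -fE !(pcoefB, pcoefD, pcoefN, pcoefZ) !(selD, selN, selM).
congr (_ + _ - _ * _).
- rewrite !pcoef_path_mul //; case: ifP => [/andP[/eqP vp /eqP bp]|_]; last by rewrite sel0.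
  have bE : b = p.2 ++ drop (size p.2) b by rewrite -{1}bp cat_take_drop.
  have dB : is_basis (target p, drop (size p.2) b).
    by move: vB; rewrite {1}bE vp => /is_basis_cat[_]; case: (p).
  rewrite pcoef_located // qsB /located_coef /=.
  rewrite ifN; last by apply: contraNneq wb => wE; rewrite /word /= -/(word qs) wE -bE.
  have tE : (take c (p.2 ++ word qs) == take c b)
      = (take (c - size p.2) (word qs) == take (c - size p.2) (drop (size p.2) b)).
    rewrite {1}bE !take_cat; case: ltnP => [lt_c|_]; last by rewrite eqseq_cat ?eqxx.
    by rewrite (eqP (ltnW lt_c)) !take0 !eqxx.
  by rewrite /sel -[word (p :: qs)]/(p.2 ++ word qs) tE.
- rewrite -bdiff_coef -[RHS]/(sel (pcoef _ _)) -bdiff_coef.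
  rewrite (@eq_bdiff_paths _ _ (fun s => sel (pcoef (f s) (v, b)))
    m.+1 p.1 (word (p :: qs))) //.
  + by apply: (bdiff_morph mul (L := sel)) => l l'; rewrite selD selN.
  + exact/kills_zero_coef/located_multilinear.
  + by move=> s t st; rewrite (multilinear0 f_multilinear) ?pcoef0.
  move=> q r [sr] _ wE; rewrite pcoef_located //; case: ifP => qB.
    by rewrite /located_coef wE /= (negPf wb).
  by rewrite f_support_basis ?qB ?pcoef0 //= sr.
case/lastP: qs sq psB qsB wb @sel selD selM selN sel0 fE => [//|qs q].
rewrite size_rcons all_rcons => -[sq] _ /andP[qB qsB] wb sel selD selM selN sel0 fE.
rewrite vecs_cons_rcons !rpart_rcons !pcoef_mul_path //.
case: ifP => [/andP[/eqP bq /eqP vq]|_]; last by rewrite sel0.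
set b' := take _ b in vq *; have bE : b = b' ++ q.2 by rewrite -bq cat_take_drop.
have b'B : is_basis (v, b') by move: vB; rewrite bE => /is_basis_cat[].
have wE : word (p :: rcons qs q) = word (p :: qs) ++ q.2.
  by rewrite /word /= map_rcons flatten_rcons catA.
have wb' : word (p :: qs) != b' by apply: contraNneq wb => wE'; rewrite wE wE' -bE.
rewrite pcoef_located //= pB qsB /= /located_coef /= (negPf wb') /sel wE bE.
have [->|c0] := eqVneq (pcoef (f (vecs (p :: qs))) (v, b')) 0; first by rewrite !if_same.
have /andP[n1 n2] := support_word (congr1 S sq : size (p :: qs) = _) b'B c0 wb'.
by rewrite eq_take_cat.
Qed.

Lemma path_tail_cat c v a b : (size a <= c)%N ->
  path_tail c (v, a ++ b) = path_tail (c - size a) (target (v, a), b).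
Proof.
move=> le_ac; rewrite /path_tail /= take_cat drop_cat ltnNge le_ac /=.
by rewrite target_cat.
Qed.

Lemma located_diag_lt c p qs u : size qs = m -> is_basis u ->
  word (p :: qs) = u.2 -> (size p.2 < c)%N ->
  pcoef (located c (vecs (p :: qs))) u = pcoef (f (vecs (p :: qs))) u.
Proof.
move=> sq uB wu lt_pc; rewrite pcoef_located //.
case: ifP => [_|/negbT nB]; last by rewrite f_support_basis ?pcoef0 //= sq.
by rewrite /located_coef wu eqxx leqNgt lt_pc subr0.
Qed.

Lemma located_diag_ge c p qs u : size qs = m -> is_basis p -> is_basis u ->
  word (p :: qs) = u.2 -> (c <= size p.2)%N ->
  pcoef (located c (vecs (p :: qs))) u = pcoef (f (vecs (p :: qs))) u
    - pcoef (f (path_vec (path_tail c p) :: vecs qs)) (path_tail c u).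
Proof.
move=> sq pB uB wu le_cp; rewrite pcoef_located //.
case: ifP => [_|/negbT nB]; first by rewrite /located_coef wu eqxx le_cp.
rewrite f_support_basis ?pcoef0 //= ?sq // sub0r.
have nB' : ~~ all is_basis qs by move: nB; rewrite /= pB.
rewrite -[_ :: _]/(vecs (path_tail c p :: qs)) f_support_basis ?pcoef0 ?oppr0 //= ?sq //.
by rewrite negb_and nB' orbT.
Qed.

Lemma hdiff_coef0 s u : size s = m.+2 ->
  pcoef (bdiff mul f s) u - (-1) ^+ m.+1 * pcoef (rpart mul f s) u
  = - pcoef (lpart mul f s) u.
Proof.
move=> ss; apply/eqP; rewrite -addr_eq0 addrC addrA -pcoefZ -pcoefD -pcoefB.
by rewrite -hdiffE // f_cocycle // pcoef0.
Qed.

(** The inner and right outer terms are differences of those for [f] at [p :: qs] and at [p' :: qs],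
    where [p'] is the tail of [p]. The two cocycle identities turn them into the left outer terms,
    which have the same coefficient and cancel. *)
Lemma located_cocycle_diag_ge c p qs b : size qs = m.+1 -> is_basis (p.1, b) ->
  all is_basis (p :: qs) -> word (p :: qs) = b -> (c <= size p.2)%N ->
  pcoef (mul (path_vec p) (located (c - size p.2) (vecs qs))
        + bdiff mul (located c) (vecs (p :: qs))
        - (-1) ^+ m.+1 *: rpart mul (located c) (vecs (p :: qs))) (p.1, b) = 0.
Proof.
move=> sq bB psB wb le_cp.
have [pB qsB] : is_basis p /\ all is_basis qs by apply/andP.
set u := (p.1, b); set p' := path_tail c p; set u' := path_tail c u.
have bE : b = p.2 ++ word qs by rewrite -wb.
have tb : take c b = take c p.2 by rewrite bE takel_cat.
have u'B : is_basis u'.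
  by move: bB; rewrite -(cat_take_drop c b) => /is_basis_cat[].
have sp' : size p'.2 = (size p.2 - c)%N by rewrite size_drop.
have db : drop c b = p'.2 ++ word qs.
  by rewrite bE dropl_cat.
have tp' : target p' = target p.
  by rewrite /p' /path_tail -target_cat cat_take_drop -surjective_pairing.
rewrite (eqP le_cp : (c - size p.2 = 0)%N) located0 ?size_map //.
rewrite (amul0r malg_mul_linr) add0r pcoefB pcoefZ.
have -> : pcoef (bdiff mul (located c) (vecs (p :: qs))) u
    = pcoef (bdiff mul f (vecs (p :: qs))) u
      - pcoef (bdiff mul f (path_vec p' :: vecs qs)) u'.
  case: qs sq psB qsB wb bE db => [//|q r] [sr] psB qsB wb bE db.
  rewrite -bdiff_coef -[vecs (p :: q :: r)]/(path_vec p :: path_vec q :: vecs r).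
  rewrite -[vecs (q :: r)]/(path_vec q :: vecs r) !bdiff_cons2 !pcoefB !pcoefN.
  rewrite -!bdiff_coef.
  have -> : bdiff mul (fun s => pcoef (located c (path_vec p :: s)) u) (path_vec q :: vecs r)
      = bdiff mul (fun s => pcoef (f (path_vec p :: s)) u
                            - pcoef (f (path_vec p' :: s)) u') (path_vec q :: vecs r).
    apply: (@eq_bdiff_paths _ _ _ m q.1 (word (q :: r)) q r) => //.
    - by move=> s t st; rewrite (multilinear0 (u := path_vec p :: s)
        (@located_multilinear c)) ?pcoef0 //= addSn st.
    - move=> s t st; rewrite (multilinear0 (u := path_vec p :: s)
        f_multilinear) /= ?addSn ?st //.
      by rewrite (multilinear0 (u := path_vec p' :: s)
        f_multilinear) /= ?addSn ?st // !pcoef0 subrr.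
    move=> q1 r1 sr1 q1E w1; apply: (@located_diag_ge c p (q1 :: r1)) => //.
    by rewrite /u /= bE -w1.
  rewrite bdiffB; have -> : pcoef (located c (mul (path_vec p) (path_vec q) :: vecs r)) u
      = pcoef (f (mul (path_vec p) (path_vec q) :: vecs r)) u
        - pcoef (f (mul (path_vec p') (path_vec q) :: vecs r)) u'.
    rewrite !path_vec_mul tp'; case: eqP => pq; last first.
      rewrite (multilinear0 (u := [::]) (@located_multilinear c)) ?size_map ?sr //.
      by rewrite (multilinear0 (u := [::]) f_multilinear) ?size_map ?sr // !pcoef0 subrr.
    have pqB : is_basis (p.1, p.2 ++ q.2).
      by move: bB; rewrite bE /word /= catA => /is_basis_cat[].
    have := @located_diag_ge c (p.1, p.2 ++ q.2) r u sr pqB bB.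
    rewrite /= size_cat => ->; first last.
    - exact: leq_trans le_cp (leq_addr _ _).
    - by rewrite bE /word /= catA.
    congr (_ - pcoef (f (path_vec _ :: _)) _).
    by rewrite /path_tail /= takel_cat // dropl_cat.
  ring.
have -> : pcoef (rpart mul (located c) (vecs (p :: qs))) u
    = pcoef (rpart mul f (vecs (p :: qs))) u
      - pcoef (rpart mul f (path_vec p' :: vecs qs)) u'.
  case/lastP: qs sq psB qsB wb bE db => [//|qs q]; rewrite size_rcons => -[sq] _ _ wb bE db.
  rewrite vecs_cons_rcons -[path_vec p' :: _]/(vecs (p' :: rcons qs q)) vecs_cons_rcons.
  rewrite !rpart_rcons.
  have wE : b = word (p :: qs) ++ q.2.
    by rewrite -wb /word /= map_rcons flatten_rcons catA.
  have le_cw : (c <= size (word (p :: qs)))%N.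
    by rewrite /word /= size_cat (leq_trans le_cp) ?leq_addr.
  have wB : is_basis (p.1, word (p :: qs)) by move: bB; rewrite {1}wE => /is_basis_cat[].
  have := @located_diag_ge c p qs (p.1, word (p :: qs)) sq pB wB erefl le_cp.
  rewrite pcoef_mul_path // pcoef_mul_path // [pcoef _ u']pcoef_mul_path //.
  move: (word (p :: qs)) wE le_cw {wb wB} => w wE le_cw located_w.
  have -> : take (size b - size q.2) b = w by rewrite wE size_cat addnK take_size_cat.
  have -> : drop (size b - size q.2) b = q.2 by rewrite wE size_cat addnK drop_size_cat.
  have dE : drop c b = drop c w ++ q.2 by rewrite wE dropl_cat.
  rewrite /= dE size_cat addnK drop_size_cat // take_size_cat // eqxx /= located_w.
  have -> : target (target (p.1, take c b), drop c w) = target (p.1, w).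
    by rewrite wE takel_cat // -target_cat cat_take_drop.
  case: ifP => _; last by rewrite subrr.
  congr (_ - pcoef _ _); rewrite /path_tail /=; congr (target (_, _), _).
  by rewrite wE takel_cat.
have split (x1 x2 y1 y2 l : k) :
  x1 - x2 - l * (y1 - y2) = (x1 - l * y1) - (x2 - l * y2) by ring.
rewrite split !hdiff_coef0 ?[size _]/= ?size_map ?sq //.
rewrite opprK !pcoef_path_mul //= -/u' -/p' tp' -/(word qs).
have -> : take (size p.2) b = p.2 by rewrite bE take_size_cat.
have -> : drop (size p.2) b = word qs by rewrite bE drop_size_cat.
rewrite !eqxx /= db take_size_cat // drop_size_cat // eqxx.
by rewrite tb eqxx addNr.
Qed.

(** Corrections can occur only in the left outer term and in the product of [p] with the next path
    [q]. They are there if letter [c] of the word is not beyond [q]; both then use the same tail of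
    [q] and cancel, leaving the identity for [f]. *)
Lemma located_cocycle_diag_lt c p qs b : size qs = m.+1 -> is_basis (p.1, b) ->
  all is_basis (p :: qs) -> word (p :: qs) = b -> (size p.2 < c)%N ->
  pcoef (mul (path_vec p) (located (c - size p.2) (vecs qs))
        + bdiff mul (located c) (vecs (p :: qs))
        - (-1) ^+ m.+1 *: rpart mul (located c) (vecs (p :: qs))) (p.1, b) = 0.
Proof.
move=> sq bB psB wb lt_pc.
have [pB qsB] : is_basis p /\ all is_basis qs by apply/andP.
set u := (p.1, b); have bE : b = p.2 ++ word qs by rewrite -wb.
have u'B : is_basis (target p, word qs).
  by move: bB; rewrite bE => /is_basis_cat[_]; rewrite -surjective_pairing.
have mulE x : pcoef (mul (path_vec p) x) u = pcoef x (target p, word qs).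
  by rewrite pcoef_path_mul // eqxx bE take_size_cat // eqxx drop_size_cat.
have fE : pcoef (lpart mul f (vecs (p :: qs)) + bdiff mul f (vecs (p :: qs))
    - (-1) ^+ m.+1 *: rpart mul f (vecs (p :: qs))) u = 0.
  by rewrite -hdiffE ?f_cocycle ?pcoef0 //= size_map sq.
rewrite -fE !(pcoefB, pcoefD, pcoefN, pcoefZ) [lpart _ _ _]/= !mulE; congr (_ - _ * _).
  case: qs sq psB qsB wb bE u'B mulE fE => [//|q r] [sr] psB qsB wb bE u'B mulE fE.
  rewrite -[vecs (p :: q :: r)]/(path_vec p :: path_vec q :: vecs r).
  rewrite !bdiff_cons2 !pcoefB !pcoefN.
  rewrite -[pcoef (bdiff _ (fun s => located c (path_vec p :: s)) _) _]bdiff_coef.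
  have -> : bdiff mul (fun s => pcoef (located c (path_vec p :: s)) u) (path_vec q :: vecs r)
      = bdiff mul (fun s => pcoef (f (path_vec p :: s)) u) (path_vec q :: vecs r).
    apply: (@eq_bdiff_paths _ _ _ m q.1 (word (q :: r)) q r) => //.
    - by move=> s t st; rewrite (multilinear0 (u := path_vec p :: s)
        (@located_multilinear c)) ?pcoef0 //= addSn st.
    - by move=> s t st; rewrite (multilinear0 (u := path_vec p :: s)
        f_multilinear) /= ?pcoef0 ?addSn ?st.
    move=> q1 r1 sr1 q1E w1; apply: (@located_diag_lt c p (q1 :: r1)) => //.
    by rewrite /u /= bE -w1.
  rewrite bdiff_coef !addrA; congr (_ - _).
  rewrite path_vec_mul; have [pq|npq] := eqVneq (target p) q.1; last first.
    rewrite (located_start _ sr u'B npq).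
    rewrite (multilinear0 (u := [::]) (@located_multilinear c)) ?size_map ?sr //.
    rewrite (multilinear0 (u := [::]) f_multilinear) ?size_map ?sr // pcoef0 subr0.
    have [-> //|c0] := eqVneq (pcoef (f (vecs (q :: r))) (target p, word (q :: r))) 0.
      by rewrite subr0.
    by have := support_start sr u'B c0; move/eqP: npq.
  have pqB : is_basis (p.1, p.2 ++ q.2).
    by move: bB; rewrite bE /word /= catA => /is_basis_cat[].
  have [le_c|lt_c] := leqP c (size p.2 + size q.2).
    have qB : is_basis q by move: qsB => /= /andP[].
    rewrite (@located_diag_ge _ q r) //; last by rewrite leq_subLR.
    have tq : path_tail c (p.1, p.2 ++ q.2) = path_tail (c - size p.2) q.
      by rewrite path_tail_cat 1?ltnW // -surjective_pairing pq -surjective_pairing.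
    have tu : path_tail c u = path_tail (c - size p.2) (target p, word (q :: r)).
      by rewrite /u bE path_tail_cat 1?ltnW // -surjective_pairing.
    rewrite -[X in located c X]/(vecs ((p.1, p.2 ++ q.2) :: r)).
    rewrite (@located_diag_ge c (p.1, p.2 ++ q.2) r u sr pqB bB) /= ?size_cat //.
      by rewrite tq tu opprB addrA subrK.
    by rewrite bE /word /= catA.
  rewrite (@located_diag_lt _ q r) //; last by rewrite ltn_subRL.
  rewrite -[X in located c X]/(vecs ((p.1, p.2 ++ q.2) :: r)).
  rewrite (@located_diag_lt c (p.1, p.2 ++ q.2) r u sr bB) //= ?size_cat //.
  by rewrite bE /word /= catA.
case/lastP: qs sq psB qsB wb bE u'B mulE fE => [//|qs q].
rewrite size_rcons => -[sq] _ _ wb _ _ _ _.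
rewrite vecs_cons_rcons !rpart_rcons !pcoef_mul_path //.
have wE : b = word (p :: qs) ++ q.2.
  by rewrite -wb /word /= map_rcons flatten_rcons catA.
case: ifP => // _; apply: located_diag_lt => //=.
  by move: bB; rewrite -{1}(cat_take_drop (size b - size q.2) b) => /is_basis_cat[].
move: (word (p :: qs)) wE => w ->.
by rewrite size_cat addnK take_size_cat.
Qed.

(* For [c <= size p.2] the subtraction is truncated and [located 0] vanishes: what acts
   before letter [c] of the whole word does not reach the remaining arguments. *)
Lemma located_cocycle c p s : size s = m.+1 ->
  mul (path_vec p) (located (c - size p.2) s)
  + bdiff mul (located c) (path_vec p :: s)
  - (-1) ^+ m.+1 *: rpart mul (located c) (path_vec p :: s) = 0.
Proof.
have lin := malg_mul_linl; have linr := malg_mul_linr.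
have Ll := @located_multilinear.
have [pB|npB] := boolP (is_basis p); last first.
  move=> ss; rewrite path_vec_nbasis // (amul0l lin) add0r.
  have bl := multilinear_bdiff lin linr (Ll c).
  have rl := multilinear_rpart lin linr (Ll c).
  rewrite (multilinear0 (u := [::]) bl) ?ss // (multilinear0 (u := [::]) rl) ?ss //.
  by rewrite scaler0 subr0.
move: s; apply: paths_eq0.
  apply: multilinearB; first apply: multilinearD.
  - by move=> u v x y l suv; rewrite Ll // linr.
  - exact/multilinear_cons/multilinear_bdiff.
  exact/multilinearZ/multilinear_cons/multilinear_rpart.
move=> ts sts; set qs := map val ts.
have sq : size qs = m.+1 by rewrite size_map.
have psB : all is_basis (p :: qs).
  by rewrite /= pB; apply/allP => q /mapP[t _ ->]; apply: is_basis_val.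
apply: pcoefP => -[v b] vB; rewrite pcoef0.
have [vE|vp] := eqVneq v p.1; last exact: located_cocycle_start.
have [wb|wb] := eqVneq (word (p :: qs)) b; last exact: located_cocycle_core.
rewrite vE in vB *; have [le_c|lt_c] := leqP c (size p.2).
  exact: located_cocycle_diag_ge.
exact: located_cocycle_diag_lt.
Qed.

Lemma located_low c s u : size s = m.+1 -> is_basis u -> (size u.2 <= c)%N ->
  pcoef (located c s) u = pcoef (f s) u.
Proof.
(* The coefficient is placed on [path_vec u] because [paths_eq0] is about cochains with values in
   [M]. *)
move=> ss uB le_u; pose Phi s := pcoef (located c s - f s) u *: path_vec u.
suff Phi0 : Phi s = 0.
  have := congr1 (pcoef^~ u) Phi0; rewrite /Phi /= pcoefZ pcoef_path_vec // eqxx.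
  rewrite mulr1 pcoef0 pcoefB => /eqP.
  by rewrite subr_eq0 => /eqP.
move: s ss; apply: paths_eq0 => [v w x y l svw|ts sts].
  rewrite /Phi !pcoefB (@located_multilinear c _ _ _ _ _ svw) f_multilinear //.
  rewrite !pcoefD !pcoefZ !scalerBl !scalerDl scalerBr !scalerA opprD.
  by rewrite addrACA.
by rewrite /Phi pcoefB located_large ?size_map ?le_u // subrr scale0r.
Qed.

(** All paths occurring in [x] are longer than [j], so the left outer term in [located_cocycle]
    contains [located 0], which is 0. *)
Lemma located_after j x s : (forall u, is_basis u -> (size u.2 <= j)%N -> pcoef x u = 0) ->
  size s = m.+1 ->
  bdiff mul (located j) (x :: s) = (-1) ^+ m.+1 *: rpart mul (located j) (x :: s).
Proof.
move=> x_high ss; have lin := malg_mul_linl; have linr := malg_mul_linr.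
pose Phi s := bdiff mul (located j) s - (-1) ^+ m.+1 *: rpart mul (located j) s.
have Phil : multilinear m.+2 Phi.
  apply: multilinearB; first by apply: multilinear_bdiff => //; apply: located_multilinear.
  by apply: multilinearZ; apply: multilinear_rpart => //; apply: located_multilinear.
apply/eqP; rewrite -subr_eq0 -/(Phi _) (decompose x) -[_ :: s]cat0s.
rewrite (multilinear_suml _ _ _ Phil) /= ?ss // big1 // => t _.
have := Phil [::] s (path_vec (val t)) 0 (x t).
rewrite /= addr0 (multilinear0 (u := [::]) Phil) /= ?ss // addr0 => -> //.
have [le_tj|lt_jt] := leqP (size (val t).2) j.
  by rewrite -pcoef_val x_high ?is_basis_val ?scale0r.
have := located_cocycle j (val t) ss.
rewrite (eqP (ltnW lt_jt) : (j - size (val t).2 = 0)%N) located0 // (amul0r linr) add0r.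
by move=> Phi0; rewrite /Phi /= Phi0 scaler0.
Qed.
End Support.
End PathAlgebra.

(** * Cup products *)

Section CupProduct.
Variables (k : fieldType) (V E : finType) (src tgt : E -> V) (rels : seq (seq E)).
Hypothesis Q_triangular : triangular src tgt.
Notation P := (V * seq E)%type.
Notation B := (@mbasis V E src tgt rels).
Notation M := (malg src tgt rels k).
Notation mul := (@malg_mul V E src tgt rels k).
Notation target := (path_end tgt).
Notation path_vec := (@path_vec k V E src tgt rels).
Notation vecs := (@vecs k V E src tgt rels).
Notation idem := (@idem k V E src tgt rels).
Let mulA : associative mul := @malg_mulA k V E src tgt rels.
Let linl := @malg_mul_linl k V E src tgt rels.
Let linr := @malg_mul_linr k V E src tgt rels.

(* A path with its length recorded separately: the zero product of two paths
   still has a length, which keeps [deg] additive. *)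
Definition graded_path := (nat * option P)%type.

Definition deg (x : graded_path) := x.1.

Definition graded_vec (x : graded_path) : M :=
  if x.2 is Some p then if size p.2 == x.1 then path_vec p else 0 else 0.

Definition graded_mul (x y : graded_path) : graded_path :=
  (x.1 + y.1, if (x.2, y.2) is (Some p, Some q) then
     if [&& size p.2 == x.1, size q.2 == y.1 & target p == q.1]
     then Some (p.1, p.2 ++ q.2) else None
   else None)%N.

Definition grade (p : P) : graded_path := (size p.2, Some p).

Lemma graded_vec_grade p : graded_vec (grade p) = path_vec p.
Proof. by rewrite /graded_vec /= eqxx. Qed.

Lemma graded_vecM : {morph graded_vec : x y / graded_mul x y >-> mul x y}.
Proof.
have m0l := amul0l linl; have m0r := amul0r linr.
move=> [i [p|]] [j [q|]]; rewrite /graded_vec /= ?m0l ?m0r //.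
have [<-|ni] /= := eqVneq; last by rewrite m0l.
have [<-|nj] /= := eqVneq; last by rewrite m0r.
by rewrite path_vec_mul; case: eqP => //= pq; rewrite size_cat eqxx.
Qed.

(** A graded path with nonzero value is [grade] of a basis path, where [ext] returns [H]; if some
    entry has value 0, both sides vanish. *)
Lemma ext_graded (H : seq graded_path -> M) xs :
  (forall u x w, (size u + size w).+1 = size xs -> graded_vec x = 0 ->
     H (u ++ x :: w) = 0) ->
  ext (fun ts : seq B => H (map (fun t => grade (val t)) ts)) (map graded_vec xs) = H xs.
Proof.
elim: xs H => [|x xs IH] H H0 //.
have [x0|nx0] := eqVneq (graded_vec x) 0.
  rewrite (H0 [::] x xs) //= x0 big1 // => t _.
  by rewrite [(0 : M) t]ffunE scale0r.
case: x nx0 H0 => i [p|]; last by rewrite /graded_vec /= eqxx.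
have [<-|ni] := eqVneq (size p.2) i; last by rewrite /graded_vec /= (negPf ni) eqxx.
rewrite -[(_, Some p)]/(grade p) map_cons graded_vec_grade.
have [/is_basisP[t ->] _ H0|np] := boolP (is_basis src tgt rels p); last first.
  by rewrite path_vec_nbasis ?eqxx.
rewrite (ext_path (fun ts => H (map (fun t => grade (val t)) ts))).
rewrite (IH (fun ys => H (grade (val t) :: ys))) // => u x w suw x0.
by rewrite -cat_cons H0 //= addSn suw.
Qed.

(** * The homotopy for two normalised cocycles *)

Section NormalCocycles.
Variables (m n : nat) (f g : seq M -> M).
Hypothesis f_multilinear : multilinear m.+1 f.
Hypothesis g_multilinear : multilinear n.+1 g.
Hypothesis f_cocycle : cocycle mul m.+1 f.
Hypothesis g_cocycle : cocycle mul n.+1 g.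
Hypothesis f_normal : normal idem m.+1 f.
Hypothesis g_normal : normal idem n.+1 g.

(** An upper bound for the length of a word made of [n.+1] basis paths, each shorter than [#|V|]. *)
Let bound := (n.+1 * #|V|)%N.
Let F := located f.
(** The part of [g] at letter [j] alone, whereas [F c] collects all letters before [c]: in the
    circle product [f] then acts strictly to the left of [g]. *)
Let G j s := located g j.+1 s - located g j s.

Let homotopy_path xs := circle deg graded_vec n.+1 bound G m.+1 0 F xs.
Let homotopy := ext (fun ts : seq B => homotopy_path (map (fun t => grade (val t)) ts)).

Lemma F_multilinear c : multilinear m.+1 (F c).
Proof. exact: located_multilinear. Qed.

Lemma G_multilinear j : multilinear n.+1 (G j).
Proof. by apply: multilinearB; apply: located_multilinear. Qed.

Lemma located_graded (l : nat) (h : seq M -> M) c x s :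
  multilinear l.+1 h -> cocycle mul l.+1 h -> normal idem l.+1 h -> size s = l.+1 ->
  mul (graded_vec x) (located h (c - deg x) s)
  + bdiff mul (located h c) (graded_vec x :: s)
  - (-1) ^+ l.+1 *: rpart mul (located h c) (graded_vec x :: s) = 0.
Proof.
move=> hl hc hn ss; have zero d : mul 0 (located h d s)
    + bdiff mul (located h c) (0 :: s)
    - (-1) ^+ l.+1 *: rpart mul (located h c) (0 :: s) = 0.
  have Ll := @located_multilinear k V E src tgt rels l h c.
  have bl := multilinear_bdiff linl linr Ll.
  have rl := multilinear_rpart linl linr Ll.
  rewrite (amul0l linl) (multilinear0 (u := [::]) bl) ?ss //.
  by rewrite (multilinear0 (u := [::]) rl) ?ss // scaler0 subr0 addr0.
case: x => i [p|] //; rewrite /graded_vec /deg /=; case: eqP => // <-.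
exact: located_cocycle.
Qed.

(** The difference of the identities of [located g] at [j.+1] and at [j]. If letter [j] lies inside
    [x], both truncated subtractions are 0 and the left outer terms cancel. *)
Lemma G_cocycle j x s : size s = n.+1 ->
  (if (deg x <= j)%N then mul (graded_vec x) (G (j - deg x) s) else 0)
  + bdiff mul (G j) (graded_vec x :: s)
  - (-1) ^+ n.+1 *: rpart mul (G j) (graded_vec x :: s) = 0.
Proof.
move=> ss; have E1 := located_graded j.+1 x g_multilinear g_cocycle g_normal ss.
have E0 := located_graded j x g_multilinear g_cocycle g_normal ss.
rewrite bdiffB.
have -> : rpart mul (G j) (graded_vec x :: s)
    = rpart mul (located g j.+1) (graded_vec x :: s)
      - rpart mul (located g j) (graded_vec x :: s) by rewrite /= (amulBl linl).
have -> : (if (deg x <= j)%N then mul (graded_vec x) (G (j - deg x) s) else 0)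
    = mul (graded_vec x) (located g (j.+1 - deg x) s)
      - mul (graded_vec x) (located g (j - deg x) s).
  case: leqP => [le_xj|lt_jx]; first by rewrite -(amulBr linr) subSn.
  by rewrite (eqP lt_jx) (eqP (ltnW lt_jx)) subrr.
rewrite scalerBr [X in X - _]addrACA -opprD.
set a1 := mul _ _ in E1 *; set a0 := mul _ _ in E0 *.
set b1 := bdiff _ _ _ in E1 *; set b0 := bdiff _ _ _ in E0 *.
set r1 := _ *: rpart _ _ _ in E1 *; set r0 := _ *: rpart _ _ _ in E0 *.
rewrite opprB addrACA [- (a0 + b0) - r1]addrC -[r0 in X in X + _]opprK.
have -> : a1 + b1 = r1 by apply/eqP; rewrite -subr_eq0 E1.
have -> : a0 + b0 = r0 by apply/eqP; rewrite -subr_eq0 E0.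
by rewrite opprK addrACA subrr add0r subrr.
Qed.

(** At an output of length at most [j] all of [g] has already acted before letter [j]. *)
Lemma G_high j s u : size s = n.+1 -> is_basis src tgt rels u -> (size u.2 <= j)%N ->
  pcoef (G j s) u = 0.
Proof.
move=> ss uB le_u; rewrite /G pcoefB.
rewrite (located_low g_multilinear g_cocycle g_normal Q_triangular ss uB (leqW le_u)).
by rewrite (located_low g_multilinear g_cocycle g_normal Q_triangular ss uB le_u) subrr.
Qed.

Lemma le_bound : (#|V| <= bound)%N.
Proof. by rewrite /bound mulSn leq_addr. Qed.

Lemma G_bounded j x s : size s = n.+1 -> (bound <= deg x + j)%N ->
  mul (graded_vec x) (G j s) = 0.
Proof.
move=> ss; case: x => i [p|]; rewrite /graded_vec /deg /= ?(amul0l linl) //.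
case: eqP => [<-|] le_b; last by rewrite (amul0l linl).
apply: pcoefP => -[v b] vB; rewrite pcoef0 pcoef_path_mul //.
case: ifP => // /andP[/eqP vE /eqP bE].
apply: G_high => //=.
  move: vB; rewrite -{1}(cat_take_drop (size p.2) b) bE vE => /is_basis_cat[_].
  by rewrite -surjective_pairing.
move: vB; rewrite is_basisE => /and3P[_ _ /ltnW lt_b].
by rewrite size_drop leq_subLR (leq_trans lt_b) // (leq_trans le_bound).
Qed.

Lemma size_word (ts : seq B) : (size (word (map val ts)) <= size ts * #|V|)%N.
Proof.
elim: ts => [|t ts IH] //; rewrite /word /= size_cat mulSn leq_add //.
by have := is_basis_val t; rewrite is_basisE => /and3P[_ _ /ltnW].
Qed.

Lemma located_total (l : nat) (h : seq M -> M) c (ts : seq B) :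
  multilinear l.+1 h -> cocycle mul l.+1 h -> normal idem l.+1 h ->
  size ts = l.+1 -> (size (word (map val ts)) <= c)%N ->
  located h c (vecs (map val ts)) = h (vecs (map val ts)).
Proof.
move=> hl hc hn sts le_c; apply: pcoefP => u uB.
by rewrite (located_large hl hc hn Q_triangular) ?size_map // le_c orbT.
Qed.

Lemma sum_G (ts : seq B) : size ts = n.+1 ->
  \sum_(0 <= j < bound) G j (vecs (map val ts)) = g (vecs (map val ts)).
Proof.
move=> sts; rewrite (telescope_sumr (fun j => located g j (vecs (map val ts)))) //.
rewrite (located0 g (m := n)) ?size_map // subr0 (@located_total n) //.
by rewrite (leq_trans (size_word ts)) // sts.
Qed.

Lemma total_degree_grade (ts : seq B) :
  total_degree deg (map (fun t => grade (val t)) ts) = size (word (map val ts)).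
Proof.
by elim: ts => [|t ts IH] //; rewrite /word /= size_cat -[size (flatten _)]IH.
Qed.

Lemma map_graded_vec (ts : seq B) :
  map graded_vec (map (fun t => grade (val t)) ts) = vecs (map val ts).
Proof. by elim: ts => [|t ts IH] //=; rewrite IH graded_vec_grade. Qed.

Lemma cut_sum_grade (ts : seq B) : size ts = (m.+1 + n.+1)%N ->
  cut_sum mul deg graded_vec bound G m.+1 0 F (map (fun t => grade (val t)) ts)
  = hcup mul m.+1 f g (vecs (map val ts)).
Proof.
move=> sts; rewrite /cut_sum /hcup.
have -> : take m.+1 (vecs (map val ts)) = vecs (map val (take m.+1 ts)).
  by rewrite /vecs !map_take.
have -> : drop m.+1 (vecs (map val ts)) = vecs (map val (drop m.+1 ts)).
  by rewrite /vecs !map_drop.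
rewrite -sum_G; last by rewrite size_drop sts addKn.
rewrite (amul_sumr linr); apply: eq_bigr => j _.
rewrite -!map_take -!map_drop !map_graded_vec add0n total_degree_grade.
by rewrite [F _ _](@located_total m) ?leq_addr // size_takel // sts leq_addr.
Qed.

Lemma homotopy_graded xs : size xs = (m + n).+1 ->
  homotopy (map graded_vec xs) = homotopy_path xs.
Proof.
move=> sxs; apply: ext_graded => u x w suw x0; rewrite /homotopy_path.
apply: circle_eq0 => //; [exact: G_multilinear | exact: F_multilinear |].
by rewrite suw sxs addnS addSn addnC.
Qed.

Lemma hdiff_homotopy (ts : seq B) : size ts = (m.+1 + n.+1)%N ->
  hdiff mul (m + n).+1 homotopy (vecs (map val ts))
  = - ((-1) ^+ n.+1) ^+ m.+2 *: hcup mul m.+1 f g (vecs (map val ts)).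
Proof.
move=> sts; rewrite -cut_sum_grade // hdiffE; last by rewrite !size_map sts addnS addSn.
rewrite -map_graded_vec; set xs := map _ ts.
have sxs : size xs = (m + n).+2 by rewrite size_map sts addnS addSn.
case: xs sxs => [//|a t] [st].
have hE s : (size s).+1 = size (a :: t) -> homotopy (map graded_vec s) = homotopy_path s.
  by move=> ss; apply: homotopy_graded; apply: succn_inj; rewrite ss /= st.
have st' : (size t).+1 = (n.+1 + m.+1)%N by rewrite st addnS addSn addnC.
have key := @circle_homotopy k M mul linl linr _ deg graded_vec graded_mul _
  graded_vecM n.+1 bound G _ G_cocycle G_bounded m.+1 F F_multilinear _ _ a t st'.
rewrite -key //.
- have -> : bdiff mul homotopy (map graded_vec (a :: t))
      = bdiff graded_mul homotopy_path (a :: t).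
    by rewrite -(bdiff_map _ _ graded_vecM); apply: eq_bdiff.
  rewrite [lpart _ _ _]/= [rpart _ _ _]/= belast_map last_map !hE ?size_belast //.
  have -> : (n.+1 + m.+1)%N = (m + n).+2 by rewrite addnS addSn addnC.
  by rewrite [(-1) ^+ (m + n).+2]exprS mulN1r scaleNr.
- by move=> c x s; apply: located_graded.
move=> j v s sv ss.
apply: (located_after f_multilinear f_cocycle f_normal Q_triangular) => // u.
exact: G_high.
Qed.

Lemma hcup_normal_coboundary :
  hcoboundary mul (m.+1 + n.+1) (hcup mul m.+1 f g).
Proof.
(* The homotopy yields the cup product up to this sign, which is its own inverse. *)
pose e : k := - ((-1) ^+ n.+1) ^+ m.+2; have ee : e * e = 1.
  by rewrite /e mulrNN -!exprM -expr2 sqrr_sign.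
have mn : (m.+1 + n.+1)%N = (m + n).+2 by rewrite addnS addSn.
have hl : multilinear (m + n).+1 homotopy by apply: ext_multilinear.
exists (fun s => e *: homotopy s); rewrite {1 3}mn; split; first exact: multilinearZ.
move=> s ss; rewrite hdiff_scale //; last by rewrite ss mn.
apply/eqP; rewrite -subr_eq0; apply/eqP.
move: s ss; apply: paths_eq0 => [|ts sts].
  apply: multilinearB; last by apply: multilinear_hcup.
  by apply: multilinearZ; rewrite mn; apply: multilinear_hdiff.
by rewrite hdiff_homotopy // scalerA ee scale1r subrr.
Qed.
End NormalCocycles.

(** With [f = f' + d hf] and [g = g' + d hg], the cup product of [f] and [g] is that of [f'] and
    [g'] plus [d hf] cup [g] plus [f'] cup [d hg]. Since [g] and [f'] are cocycles, the Leibniz rule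
    makes the last two coboundaries, the second with sign [(-1) ^+ m.+1]. *)
Lemma hcup_coboundary m n (f g : seq M -> M) :
  hcocycle mul m.+1 f -> hcocycle mul n.+1 g ->
  hcoboundary mul (m.+1 + n.+1) (hcup mul m.+1 f g).
Proof.
move=> [fl fc] [gl gc].
have norm := cocycle_normalization mulA linl linr (@idem_orth k V E src tgt rels)
  (@malg_mul1l k V E src tgt rels) (@malg_mul1r k V E src tgt rels).
have [hf [hfl f'l f'c f'n]] := norm _ _ fl fc.
have [hg [hgl g'l g'c g'n]] := norm _ _ gl gc.
set f' := fun s => f s - _ in f'l f'c f'n; set g' := fun s => g s - _ in g'l g'c g'n.
have [h [hl hE]] := hcup_normal_coboundary f'l g'l f'c g'c f'n g'n.
have mn : (m.+1 + n.+1).-1 = (m + n.+1)%N by [].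
have mn' : (m + n.+1)%N = (m.+1 + n)%N by rewrite addnS addSn.
exists (fun s => 1 *: h s + (1 *: hcup mul m hf g s + (-1) ^+ m.+1 *: hcup mul m.+1 f' hg s)).
rewrite mn in hl hE *; split.
  apply: multilinear_lin => //; apply: multilinear_lin; first exact: multilinear_hcup.
  by rewrite mn'; apply/multilinearZ/multilinear_hcup.
move=> s ss; have ss' : size s = (m + n.+1).+1 by rewrite ss.
rewrite (hdiff_lin linl linr) // (hdiff_lin linl linr) // (hdiff_scale linl linr) // !scale1r.
rewrite hE // (hcup_leibniz mulA linl linr) // [in X in _ + (_ + X)]mn'.
rewrite (hcup_leibniz mulA linl linr); last by rewrite -mn'.
rewrite gc; last by rewrite size_drop ss' subSn ?addKn ?leq_addr.
rewrite f'c; last by rewrite size_takel // ss' addnS !ltnS leq_addr.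
rewrite (amul0l linl) (amul0r linr) scaler0 addr0 add0r signrZK /hcup /f' /g'.
by rewrite (amulBr linr) [X in _ + X]addrC addrA subrK (amulBl linl) subrK.
Qed.
End CupProduct.

Theorem mainTheorem14 (k : fieldType) (V E : finType) (src tgt : E -> V)
  (rels : seq (seq E))
  (hrels : forall r, r \in rels -> (2 <= size r)%N /\ composable src tgt r)
  (htri : triangular src tgt)
  (m n : nat) (hm : (1 <= m)%N) (hn : (1 <= n)%N)
  (f g : seq (malg src tgt rels k) -> malg src tgt rels k)
  (hf : hcocycle (@malg_mul V E src tgt rels k) m f)
  (hg : hcocycle (@malg_mul V E src tgt rels k) n g) :
  hcoboundary (@malg_mul V E src tgt rels k) (m + n)
    (hcup (@malg_mul V E src tgt rels k) m f g).
Proof.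
case: m hm hf => [//|m] _ hf; case: n hn hg => [//|n] _ hg.
exact: hcup_coboundary.
Qed.
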